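(* Let $F(t,z)$ be an entire function on $\mathbb{C}^2$ satisfying the heat equation $\partial_t F=\partial_z^2F$, and let $\rho\in[0,2]$ be the $z$-order of $F$. For fixed $z\in\mathbb{C}$ let $$\rho_{t,0}(z):=\text{order of the entire function } t\mapsto F(t,z),\qquad \rho_{t,1}(z):=\text{order of the entire function } t\mapsto \partial_zF(t,z),$$ and set $$\rho_t:=\max\{\rho_{t,0}(z),\,\rho_{t,1}(z)\}.$$ Then: (i) The quantity $\rho_t$ is independent of $z$ and $$\rho_t=\frac{\rho}{2-\rho}$$ (in particular, if $\rho=2$, then $\rho_t=\infty$, while $\rho_t$ is finite if $\rho\in[0,2)$, and $\rho_t=0$ if and only if $\rho=0$). (ii) We have $\rho_{t,0}(z)=\rho_t$ and $\rho_{t,1}(z)=\rho_t$ for almost every $z\in\mathbb{C}$ (with respect to Lebesgue area measure).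
   Context: The order of an entire function $g(w)=\sum_{n\ge0}a_nw^n$ is $\limsup_{r\to\infty}\frac{\ln\ln M(r)}{\ln r}\in[0,\infty]$ with $M(r)=\max_{|w|=r}|g(w)|$; equivalently it is $\limsup_n \frac{n\ln n}{-\ln|a_n|}$ (terms with $a_n=0$ count as $0$, so polynomials, including the zero function, have order $0$). The $z$-order of $F$ is the order of the entire function $z\mapsto F(t,z)$ for fixed $t\in\mathbb{C}$; it does not depend on $t$, so it equals the order of $f(z)=F(0,z)$, and it always lies in $[0,2]$ for an entire solution of the heat equation. *)

(* Defs.v *)
From HB Require Import structures.
From mathcomp Require Import all_boot all_order all_algebra.
From mathcomp Require Import complex.
From mathcomp Require Import all_classical all_reals all_analysis.

Set Implicit Arguments.
Unset Strict Implicit.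
Unset Printing Implicit Defensive.

Import Order.TTheory GRing.Theory Num.Theory.
Import numFieldNormedType.Exports.

Local Open Scope classical_set_scope.
Local Open Scope ring_scope.

(* [R[i]^o] is the complex field seen as a normed module over itself, so that
   [derivable], ['D_1 f z], [is_derive] and [differentiable] below are the
   complex (R[i]-linear) notions. *)
Notation Cplx R := (R[i]^o).

(* For continuous g and r >= 0 the supremum is attained: it is the maximum of
   |g| on the circle of radius r. *)
Definition max_modulus (R : realType) (g : Cplx R -> Cplx R) (r : R) : R :=
  sup [set Normc.normc (g w) | w in [set w | Normc.normc w = r]].

(* Since [ln x = 0] for [x <= 0], constant functions, in particular the zero
   function, have order 0 as they should.  For nonconstant entire g, both
   logarithms of M(r) are genuine for large r. *)
Definition entire_order (R : realType) (g : Cplx R -> Cplx R) : \bar R :=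
  limf_esup (fun r : R => (ln (ln (max_modulus g r)) / ln r)%:E)
            (pinfty_nbhs R).

(* Joint complex (Frechet) differentiability at every point of C^2. *)
Definition entire2 (R : realType) (F : Cplx R -> Cplx R -> Cplx R) : Prop :=
  forall p : Cplx R * Cplx R,
    differentiable (fun q : Cplx R * Cplx R => F q.1 q.2) p.

Definition partial_t (R : realType) (F : Cplx R -> Cplx R -> Cplx R)
    (t z : Cplx R) : Cplx R := 'D_1 (fun s => F s z) t.

Definition partial_z (R : realType) (F : Cplx R -> Cplx R -> Cplx R)
    (t z : Cplx R) : Cplx R := 'D_1 (F t) z.

(* [is_derive] says that the second z-derivative exists and that its value is
   the t-derivative. *)
Definition heat_equation (R : realType)
    (F : Cplx R -> Cplx R -> Cplx R) : Prop :=
  forall t z : Cplx R, is_derive z 1 (partial_z F t) (partial_t F t z).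

Definition z_order (R : realType) (F : Cplx R -> Cplx R -> Cplx R)
    (t : Cplx R) : \bar R := entire_order (F t).

Definition t_order0 (R : realType) (F : Cplx R -> Cplx R -> Cplx R)
    (z : Cplx R) : \bar R := entire_order (fun t => F t z).

Definition t_order1 (R : realType) (F : Cplx R -> Cplx R -> Cplx R)
    (z : Cplx R) : \bar R := entire_order (fun t => partial_z F t z).

(* C is identified with R * R through (x, y) |-> x + iy. *)
Definition ae_complex (R : realType) (P : Cplx R -> Prop) : Prop :=
  {ae (lebesgue_measure \x lebesgue_measure)%E,
    forall p : R * R, P (Complex p.1 p.2)}.

(* Main.v *)
Require Import Defs.
From HB Require Import structures.
From mathcomp Require Import all_boot all_order all_algebra.
From mathcomp Require Import complex ring lra zify.
From mathcomp Require Import all_classical all_reals all_analysis.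

(** Write f = F(t0, .) and let f^(k) be its k-th derivative.

    The equation turns d^n/dt^n F and d^n/dt^n (dF/dz) at (t0, z) into
    f^(2n)(z) and f^(2n+1)(z).  On the other hand, by Cauchy's estimates and
    Taylor's formula, an entire function g has order at most s, up to the end
    point, when its derivatives at one point a, equivalently at any point, satisfy
      |g^(n)(a)| <= exp (D (n + 1) + (1 - 1/s) n ln n)
    ([derivative_growth], [order_le_of_growth]).  Restricting the exponent
    1 - 1/s of f to the even or to the odd derivatives doubles it, and
    2 (1 - 1/s) = 1 - 1/tau holds exactly for tau = s / (2 - s); conversely the
    bounds on both parities together control all the derivatives of f.  This is
    part (i) ([torder_le], [z_order_le]).  Entire functions of t have
    exponent at most 1, whence the bound 2 on the order of f ([z_order_le2]).

    For part (ii) fix the parity e.  The points z where the order is too small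
    lie in a countable union of closed sets, on each of which
    |f^(2n+e)(z)| <= exp (j (n + 1) + b n ln n) with a fixed
    b < 2 (1 - 1/rho).  By Tonelli it suffices that such a set meets every
    vertical line in a set B of length zero.  Suppose that B has positive length.
    A polynomial of degree m is bounded near the line by exp (K m) times its
    maximum over B ([remez]: Lagrange interpolation at well spaced points of B).
    Applying this to Taylor polynomials of f^(2n+e) whose degree is a large
    multiple of n shows that the same b works for f^(2n+e) on a full disc
    ([growth_near_line]), hence for f^(2n+e+1) by Cauchy's estimate; then
    f would have order less than rho.

    The complex analysis rests on Cauchy's estimate |f'(0)| <= M(r) / r for
    functions with a continuous derivative.  Here it comes from averages of f over
    roots of unity ([cauchy_estimate0]); existence of all derivatives and Taylor's
    formula follow from it. *)

Set Implicit Arguments.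
Unset Strict Implicit.
Unset Printing Implicit Defensive.

Import Order.TTheory GRing.Theory Num.Theory.
Import numFieldNormedType.Exports.

Local Open Scope classical_set_scope.
Local Open Scope complex_scope.
Local Open Scope ring_scope.

Notation normc := Normc.normc.

(** * The modulus of complex numbers *)

Section Modulus.
Context {R : realType}.
Implicit Types (x y z : R[i]) (r s : R).

Lemma normc_ge0 z : 0 <= normc z.
Proof. by case: z => a b; rewrite /normc sqrtr_ge0. Qed.

Lemma normrcE z : `|z| = (normc z)%:C.
Proof. by rewrite normc_def; case: z. Qed.

Lemma normc_real r : normc (r%:C : R[i]) = `|r|.
Proof. by rewrite /normc /= expr0n addr0 sqrtr_sqr. Qed.

Lemma normcM x y : normc (x * y) = normc x * normc y.
Proof. exact: Normc.normcM. Qed.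

Lemma normcN z : normc (- z) = normc z.
Proof. exact: normcN. Qed.

Lemma normcV z : normc z^-1 = (normc z)^-1.
Proof. exact: Normc.normcV. Qed.

Lemma normc0 : normc (0 : R[i]) = 0.
Proof. exact: Normc.normc0. Qed.

Lemma normc1 : normc (1 : R[i]) = 1.
Proof. exact: Normc.normc1. Qed.

Lemma normc_eq0 z : (normc z == 0) = (z == 0).
Proof.
apply/eqP/eqP => [|->]; first exact: Normc.eq0_normc.
exact: normc0.
Qed.

Lemma normc_gt0 z : (0 < normc z) = (z != 0).
Proof. by rewrite lt_def normc_eq0 normc_ge0 andbT. Qed.

Lemma normcX z n : normc (z ^+ n) = normc z ^+ n.
Proof.
by elim: n => [|n IH]; rewrite ?expr0 ?normc1// !exprS normcM IH.
Qed.

Lemma normc_nat n : normc (n%:R : R[i]) = n%:R.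
Proof.
have -> : n%:R = (n%:R)%:C :> R[i] by rewrite rmorph_nat.
by rewrite normc_real ger0_norm.
Qed.

Lemma normcB x y : normc (x - y) = normc (y - x).
Proof. by rewrite -opprB normcN. Qed.

Lemma le_normcB x y : normc (x - y) <= normc x + normc y.
Proof. by rewrite -(normcN y) le_normcD. Qed.

Lemma normc_tri x y z : normc (x - z) <= normc (x - y) + normc (y - z).
Proof. by have := le_normcD (x - y) (y - z); rewrite addrA subrK. Qed.

Lemma le_normc_sum n (F : 'I_n -> R[i]) :
  normc (\sum_i F i) <= \sum_i normc (F i).
Proof.
elim/big_ind2 : _ => [|x u y v xu yv|//]; first by rewrite normc0.
by rewrite (le_trans (le_normcD _ _))// lerD.
Qed.

Lemma Re_le_normc z : complex.Re z <= normc z.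
Proof.
case: z => a b /=; rewrite (le_trans (ler_norm a))// -sqrtr_sqr.
by rewrite ler_wsqrtr// lerDl sqr_ge0.
Qed.

Lemma normc_le_abs (a b : R) : normc (a +i* b) <= `|a| + `|b|.
Proof.
have -> : a +i* b = a%:C + 'i%C * b%:C :> R[i] by rewrite [LHS]complexE.
rewrite (le_trans (le_normcD _ _))// normcM !normc_real.
have -> : normc ('i%C : R[i]) = 1 by rewrite /normc /= expr0n expr1n add0r sqrtr1.
by rewrite mul1r.
Qed.

Lemma Re_abs_le_normc z : `|complex.Re z| <= normc z.
Proof.
rewrite ler_norml Re_le_normc andbT lerNl.
by have := Re_le_normc (- z); rewrite normcN; case: z.
Qed.

Lemma Im_abs_le_normc z : `|complex.Im z| <= normc z.
Proof.
case: z => a b /=; rewrite -sqrtr_sqr.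
by rewrite ler_wsqrtr// lerDr sqr_ge0.
Qed.

(** The rotation turns a bound on a modulus into one on a real part, to which
    the real mean value theorem applies. *)
Lemma normc_rot z : exists2 u, normc u = 1 & u * z = (normc z)%:C.
Proof.
have [->|z0] := eqVneq z 0.
  by exists 1; rewrite ?normc1// normc0 mulr0.
have n0 : normc z != 0 by rewrite normc_eq0.
exists ((normc z)%:C / z); last by rewrite divfK.
by rewrite normcM normcV normc_real ger0_norm ?normc_ge0// divff.
Qed.

End Modulus.

(** * Complex derivatives with real moduli *)

Section Derivative.
Context {R : realType}.
Local Notation C := (Cplx R).
Implicit Types (f g : C -> C) (z d a b : C).

Lemma gt0_complexR (e : R[i]) : 0 < e -> exists2 r : R, 0 < r & e = r%:C.
Proof.
case: e => a b; rewrite ltcE /= => /andP[/eqP-> a0]; by exists a.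
Qed.

Lemma nbhs_cplxP z (P : C -> Prop) : (\forall w \near z, P w) <->
  exists2 r : R, 0 < r & forall w, normc (w - z) < r -> P w.
Proof.
split=> [/nbhs_ballP[e /= e0 He]|[r r0 Hr]].
  have [r r0 er] := gt0_complexR e0; exists r => // w wz; apply: He.
  by rewrite /ball /= normrcE er ltcR normcB.
apply/nbhs_ballP; exists r%:C => /=; first by rewrite ltcR.
by move=> w; rewrite /ball /= normrcE ltcR normcB => /Hr.
Qed.

(** All the estimates below use derivatives through this form, which involves
    real moduli only. *)
Lemma is_derive_epsP f z d : is_derive z (1:C) f d <->
  forall e : R, 0 < e -> exists2 r, 0 < r &
    forall w, normc w < r -> normc (f (z + w) - f z - d * w) <= e * normc w.
Proof.
have E : is_derive z (1:C) f d <->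
   (fun h : C => h^-1 *: (f (h *: (1:C) + z) - f z) : C) @ (0:C)^' --> d.
  split=> [[fd <-]|fd]; first exact: fd.
  by split; [apply/cvg_ex; exists d | apply/cvg_lim].
rewrite E; split=> [/cvgrPdist_le H e e0|H].
  have eC0 : (0 : C) < e%:C by rewrite ltcR.
  have [r r0 Hr] := (nbhs_cplxP _ _).1 (H e%:C eC0).
  exists r => // w wr; have [->|w0] := eqVneq w 0.
    by rewrite addr0 subrr mulr0 subr0 normc0 mulr0.
  have := Hr w; rewrite subr0 => /(_ wr w0).
  rewrite normrcE lecR => {}Hr.
  have -> : f (z + w) - f z - d * w =
     - (w * (d - w^-1 *: (f (w *: (1:C) + z) - f z))).
    rewrite /GRing.scale /= mulr1 mulrBr mulVKf// addrC.
    by rewrite (addrC w z); ring.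
  by rewrite normcN normcM mulrC ler_wpM2r ?normc_ge0.
apply/cvgrPdist_le => e e0; have [r r0 er] := gt0_complexR e0.
have [s s0 Hs] := H r r0.
apply/nbhs_cplxP; exists s => // w; rewrite subr0 => ws w0.
rewrite normrcE er lecR -(ler_pM2r (x := normc w)); last by rewrite normc_gt0.
apply: le_trans (Hs _ ws); rewrite -normcM -normcN.
rewrite le_eqVlt; apply/orP; left; apply/eqP; congr normc.
by rewrite /GRing.scale /= mulr1 mulrBl (addrC w z); field.
Qed.
End Derivative.

(** * Mean value inequalities along segments *)

Section MeanValue.
Context {R : realType}.
Local Notation C := (Cplx R).
Implicit Types (f g df : C -> C) (z d a b : C).

Lemma real_is_derive_eps (h : R -> R) (s d : R) :
  (forall e : R, 0 < e -> exists2 r, 0 < r &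
    forall x, `|x| < r -> `|h (s + x) - h s - d * x| <= e * `|x|) ->
  is_derive s (1:R) h d.
Proof.
move=> H; have hd : (fun x : R => x^-1 *: (h (x *: (1:R) + s) - h s) : R)
    @ (0:R)^' --> d.
  apply/cvgrPdist_le => e e0; have [r r0 Hr] := H e e0.
  apply/nbhs_ballP; exists r => // x; rewrite /ball /= sub0r normrN => xr x0.
  rewrite -(ler_pM2r (x := `|x|)) ?normr_gt0//.
  apply: le_trans (Hr _ xr); rewrite -normrM -normrN le_eqVlt.
  apply/orP; left; apply/eqP; congr (`|_|).
  by rewrite /GRing.scale /= mulr1 mulrBl (addrC x s); field.
by split; [apply/cvg_ex; exists d | apply/cvg_lim].
Qed.

Lemma is_derive_Re_line f a v u s d :
  is_derive (a + s%:C * v) (1:C) f d ->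
  is_derive s (1:R) (fun x : R => complex.Re (u * f (a + x%:C * v)))
    (complex.Re (u * d * v)).
Proof.
move=> /is_derive_epsP H; apply: real_is_derive_eps => e e0.
set K := normc u * (normc v) + 1.
have K0 : 0 < K by rewrite ltr_wpDl// mulr_ge0// normc_ge0.
have [|r r0 Hr] := H (e / K); first by rewrite divr_gt0.
exists (r / (normc v + 1)).
  by rewrite divr_gt0// ltr_wpDl// normc_ge0.
move=> x xr; have vr : normc (x%:C * v) < r.
  rewrite normcM normc_real; move: xr.
  rewrite ltr_pdivlMr ?ltr_wpDl ?normc_ge0//; apply: le_lt_trans.
  by rewrite ler_wpM2l// lerDl.
have := Hr _ vr.
set E := (f _ - _ - _) => HE.
have -> : complex.Re (u * f (a + (s + x)%:C * v)) -
   complex.Re (u * f (a + s%:C * v)) - complex.Re (u * d * v) * x =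
   complex.Re (u * E).
  have -> : u * E = u * f (a + (s + x)%:C * v) - u * f (a + s%:C * v) -
     x%:C * (u * d * v).
    rewrite /E rmorphD /= mulrDl addrA; ring.
  case: (u * f (a + (s + x)%:C * v)) => ? ?.
  case: (u * f (a + s%:C * v)) => ? ?; case: (u * d * v) => ? ? /=.
  by rewrite mul0r subr0 mulrC.
apply: le_trans (Re_abs_le_normc _) _; rewrite normcM.
apply: (@le_trans _ _ (normc u * (e / K * normc (x%:C * v)))).
  by rewrite ler_wpM2l// normc_ge0.
rewrite normcM normc_real.
have -> : normc u * (e / K * (`|x| * normc v)) =
   (normc u * normc v) / K * (e * `|x|) by ring.
apply: ler_piMl; first by rewrite mulr_ge0// ltW.
by rewrite ler_pdivrMr// mul1r /K lerDl.
Qed.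

(** Rotating the increment onto the positive reals reduces this to the real mean
    value theorem for Re (u f) - phi.  A majorant phi, rather than a constant
    bound, is what produces the factor 1 / m! in Taylor's remainder. *)
Lemma mean_value_majorant f df (phi dphi : R -> R) a v :
  (forall s : R, 0 <= s <= 1 ->
     is_derive (a + s%:C * v) (1:C) f (df (a + s%:C * v))) ->
  (forall s : R, 0 <= s <= 1 -> is_derive s (1:R) phi (dphi s)) ->
  (forall s : R, 0 <= s <= 1 -> normc (df (a + s%:C * v) * v) <= dphi s) ->
  normc (f (a + v) - f a) <= phi 1 - phi 0.
Proof.
move=> Hf Hphi Hle; have [u u1 Hu] := normc_rot (f (a + v) - f a).
pose h (x : R) := complex.Re (u * f (a + x%:C * v)).
have Hh (s : R) : 0 <= s <= 1 -> is_derive s (1:R) (h - phi)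
    (complex.Re (u * df (a + s%:C * v) * v) - dphi s).
  move=> s01; apply: is_deriveB; first exact: is_derive_Re_line (Hf s s01).
  exact: Hphi.
pose dh (s : R) := complex.Re (u * df (a + s%:C * v) * v) - dphi s.
have [||c c01] := @MVT R (h - phi) dh 0 1 ltr01.
- move=> x; rewrite in_itv /= => /andP[x0 x1]; apply: Hh.
  by rewrite !ltW.
- apply: derivable_within_continuous => x; rewrite in_itv /= => x01.
  by have [] := Hh x x01.
rewrite subr0 mulr1 => Hc0.
have Hc : h 1 - phi 1 - (h 0 - phi 0) = dh c := Hc0.
have c1 : 0 <= c <= 1.
  by move: c01; rewrite in_itv /= => /andP[x0 x1]; rewrite !ltW.
have Hd : h 1 - phi 1 - (h 0 - phi 0) <= 0.
  rewrite Hc subr_le0; apply: le_trans (Hle c c1).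
  by rewrite -mulrA (le_trans (Re_le_normc _))// normcM u1 mul1r.
have : h 1 - h 0 = normc (f (a + v) - f a).
  rewrite /h mul1r mul0r addr0.
  have -> : forall x y : R[i], complex.Re x - complex.Re y = complex.Re (x - y)
    by case=> ? ? [].
  by rewrite -mulrBr Hu.
by move=> <-; move: Hd; lra.
Qed.

Lemma mean_value_bound f df a v (M : R) :
  (forall s : R, 0 <= s <= 1 ->
     is_derive (a + s%:C * v) (1:C) f (df (a + s%:C * v))) ->
  (forall s : R, 0 <= s <= 1 -> normc (df (a + s%:C * v)) <= M) ->
  normc (f (a + v) - f a) <= M * normc v.
Proof.
move=> Hf HM.
have := @mean_value_majorant f df (fun s => M * normc v * s)
  (fun=> M * normc v) a v Hf.
rewrite mulr1 mulr0 subr0; apply => s s01; last first.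
  by rewrite normcM ler_wpM2r ?normc_ge0// HM.
have := @is_deriveZ _ _ _ id (M * normc v) s 1 1 (is_derive_id _ _).
by rewrite /GRing.scale /= mulr1.
Qed.
End MeanValue.

(** * Uniformity on discs *)

Section Compactness.
Context {R : realType}.
Local Notation C := (Cplx R).

(** Compactness of squares, packaged so that uniform continuity and boundedness
    on discs are both instances. *)
Lemma disc_uniform (P : R -> C -> Prop) :
  (forall d d' z, 0 < d' -> d' <= d -> P d z -> P d' z) ->
  (forall z, exists2 d, 0 < d & forall w, normc (w - z) < d -> P d w) ->
  forall r, exists2 d, 0 < d & forall z, normc z <= r -> P d z.
Proof.
move=> Pmono Ploc r.
have /compact_near_coveringP cK :
    compact (`[- r, r]%classic `*` `[- r, r]%classic : set (R * R)).
  by apply: compact_setX; exact: segment_compact.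
have := cK R (0:R)^'+ (fun d p => P d (p.1 +i* p.2)) _.
case=> [[x y] _ /=|d /= d0 Hd].
  have [d d0 Hd] := Ploc (x +i* y).
  exists (ball x (d / 2) `*` ball y (d / 2), [set e | 0 < e <= d]) => /=.
    split; last first.
      exists d => //= e; rewrite /= sub0r normrN => ed e0.
      by rewrite e0 ltW// (le_lt_trans _ ed)// ler_norm.
    by exists (ball x (d / 2), ball y (d / 2)) => //=; split; apply: nbhsx_ballx;
      rewrite divr_gt0.
  move=> [[x' y'] e] /= [[xx yy] /andP[e0 ed]].
  apply: Pmono ed _ => //; apply: Hd.
  apply: le_lt_trans (normc_le_abs _ _) _.
  move: xx yy; rewrite /ball /= distrC (distrC y) => xx yy.
  by rewrite (splitr d) ltrD.
exists (d / 2) => [|z zr]; first by rewrite divr_gt0.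
have d20 : 0 < d / 2 by rewrite divr_gt0.
have dd : ball_ Num.norm 0 d (d / 2).
  by rewrite /= sub0r normrN gtr0_norm// ltr_pdivrMr// ltr_pMr// ltr1n.
move: (Hd _ dd d20) => /(_ (complex.Re z, complex.Im z)) /=.
case: z zr => a b /= zr; apply; split => /=; rewrite in_itv /= -ler_norml.
  by rewrite (le_trans _ zr)// (Re_abs_le_normc (a +i* b)).
by rewrite (le_trans _ zr)// (Im_abs_le_normc (a +i* b)).
Qed.

(** Continuity spelled out with real moduli; the norm of [R[i]] takes values in
    [R[i]] itself, which would clutter every estimate. *)
Definition ccontinuous (f : C -> C) := forall z (e : R), 0 < e ->
  exists2 d, 0 < d & forall w, normc (w - z) < d -> normc (f w - f z) <= e.

Lemma ccontinuous_unif f : ccontinuous f -> forall r e, 0 < e ->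
  exists2 d, 0 < d & forall z w, normc z <= r -> normc (w - z) < d ->
    normc (f w - f z) <= e.
Proof.
move=> fc r e e0.
have [d d' z d0 dd H w wz|z|d d0 Hd] := @disc_uniform
  (fun d z => forall w, normc (w - z) < d -> normc (f w - f z) <= e) _ _ r.
- by apply: H; apply: lt_le_trans dd.
- have [d d0 Hd] := fc z (e / 2) ltac:(by rewrite divr_gt0).
  have d20 : 0 < d / 2 by rewrite divr_gt0.
  exists (d / 2) => // w wz w' ww'.
  rewrite (splitr e); apply: le_trans (normc_tri _ (f z) _) _.
  rewrite lerD ?[normc (f z - _)]normcB//; apply: Hd.
    apply: le_lt_trans (normc_tri _ w _) _.
    by rewrite (splitr d) ltrD.
  by apply: lt_le_trans wz _; lra.
by exists d => // z w zr; apply: Hd.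
Qed.

Lemma ccontinuous_bounded f : ccontinuous f -> forall r,
  exists M, forall z, normc z <= r -> normc (f z) <= M.
Proof.
move=> fc r.
have [d d' z d0 dd H|z|d d0 Hd] := @disc_uniform
  (fun d z => normc (f z) <= d^-1) _ _ r.
- by apply: le_trans H _; rewrite lef_pV2// posrE (lt_le_trans d0).
- have [d d0 Hd] := fc z 1 ltr01.
  set k := normc (f z) + 1.
  have k0 : 0 < k by rewrite ltr_wpDl// normc_ge0.
  exists (Num.min d k^-1); first by rewrite lt_min d0 invr_gt0.
  move=> w wz; apply: (@le_trans _ _ k).
    have := le_normcD (f w - f z) (f z); rewrite subrK => /le_trans; apply.
    rewrite addrC lerD// Hd//; apply: lt_le_trans wz _.
    by rewrite ge_min lexx.
  rewrite -[leLHS]invrK lef_pV2 ?posrE ?invr_gt0 ?lt_min ?d0 ?invr_gt0//.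
  by rewrite ge_min lexx orbT.
by exists d^-1.
Qed.

Lemma is_derive_ccontinuous f df :
  (forall z, is_derive z (1:C) f (df z)) -> ccontinuous f.
Proof.
move=> Hf z e e0; have /is_derive_epsP/(_ 1 ltr01)[d d0 Hd] := Hf z.
set K := normc (df z) + 1.
have K0 : 0 < K by rewrite ltr_wpDl// normc_ge0.
exists (Num.min d (e / K)); first by rewrite lt_min d0 divr_gt0.
move=> w; rewrite lt_min => /andP[wd we].
have := Hd _ wd; rewrite (addrC z) subrK => {}Hd.
have := le_normcD (f w - f z - df z * (w - z)) (df z * (w - z)).
rewrite subrK => /le_trans; apply.
rewrite normcM; apply: (@le_trans _ _ (K * normc (w - z))).
  by rewrite /K mulrDl addrC lerD.
by rewrite mulrC -ler_pdivlMr// ltW.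
Qed.
End Compactness.

(** * Rules for complex derivatives *)

Section DerivativeRules.
Context {R : realType}.
Local Notation C := (Cplx R).
Implicit Types (f g df : C -> C) (z a b c d : C).

Lemma is_derive_affine f z b c d : is_derive (z * c + b) (1:C) f d ->
  is_derive z (1:C) (fun w => f (w * c + b)) (d * c).
Proof.
move=> /is_derive_epsP H; apply/is_derive_epsP => e e0.
have K0 : 0 < normc c + 1 by rewrite ltr_wpDl// normc_ge0.
have [|r r0 Hr] := H (e / (normc c + 1)); first by rewrite divr_gt0.
exists (r / (normc c + 1)) => [|w]; first by rewrite divr_gt0.
rewrite ltr_pdivlMr// => wr.
have : normc (w * c) < r.
  rewrite normcM; apply: le_lt_trans wr.
  by rewrite ler_wpM2l ?normc_ge0// lerDl.
move=> /Hr; have -> : z * c + b + w * c = (z + w) * c + b by ring.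
have -> : d * c * w = d * (w * c) by ring.
move=> /le_trans; apply; rewrite normcM.
have -> : e / (normc c + 1) * (normc w * normc c) =
  (normc c / (normc c + 1)) * (e * normc w) by ring.
apply: ler_piMl; first by rewrite mulr_ge0 ?normc_ge0// ltW.
by rewrite ler_pdivrMr// mul1r lerDl.
Qed.

Lemma is_derive_shift f z b d : is_derive (z + b) (1:C) f d ->
  is_derive z (1:C) (fun w => f (w + b)) d.
Proof.
rewrite -{1}(mulr1 z) => /is_derive_affine; rewrite mulr1.
by under eq_fun do rewrite mulr1.
Qed.

Lemma is_derive_scale f z c d : is_derive z (1:C) f d ->
  is_derive z (1:C) (fun w => c * f w) (c * d).
Proof. by move=> H; exact: (is_deriveZ c H). Qed.

Lemma is_derive_sub f g z a b :
  is_derive z (1:C) f a -> is_derive z (1:C) g b ->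
  is_derive z (1:C) (fun w => f w - g w) (a - b).
Proof. by move=> Hf Hg; exact: (is_deriveB Hf Hg). Qed.

Lemma is_derive_subl f z c d : is_derive z (1:C) f d ->
  is_derive z (1:C) (fun w => f w - c * w) (d - c).
Proof.
move=> H; have := is_deriveB H (is_deriveZ c (is_derive_id z (1:C))).
by rewrite /GRing.scale /= mulr1.
Qed.

(** The mean value inequality for f minus its linear part at a. *)
Lemma linear_approx f df a v (e : R) :
  (forall z, is_derive z (1:C) f (df z)) ->
  (forall s : R, 0 <= s <= 1 -> normc (df (a + s%:C * v) - df a) <= e) ->
  normc (f (a + v) - f a - df a * v) <= e * normc v.
Proof.
move=> Hf He.
have := @mean_value_bound R (fun z => f z - df a * z) (fun z => df z - df a)
  a v e _ He.
set X := normc _ => H; have {H} := H (fun s _ => is_derive_subl _ (Hf _)).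
by congr (normc _ <= _); ring.
Qed.
End DerivativeRules.

(** * Cauchy's estimate *)

Section Cauchy.
Context {R : realType}.
Local Notation C := (Cplx R).
Implicit Types (f g df : C -> C) (z a b c d : C).

(** Repeated square roots of -1 taken in the right half plane: there
    |s + 1|^2 >= 2, so each of them divides |w - 1|^2 by at least 2. *)
Lemma fine_root_of_unity (e : R) : 0 < e ->
  exists N (w : R[i]), [/\ (0 < N)%N, w ^+ N = 1, w != 1, normc w = 1 &
    normc (w - 1) <= e].
Proof.
move=> e0.
have step m : exists N (w : R[i]), [/\ (0 < N)%N, w ^+ N = 1, w != 1,
    normc w = 1 & normc (w - 1) ^+ 2 <= 4 / 2 ^+ m].
  elim: m => [|m [N [w [N0 wN w1 nw Hw]]]].
    exists 2, (-1); split=> //.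
    - by rewrite sqrrN expr1n.
    - by rewrite -subr_eq0 -opprD oppr_eq0 -mulr2n pnatr_eq0.
    - by rewrite normcN normc1.
    - have -> : -1 - 1 = - (2%:R) :> R[i] by ring.
      by rewrite normcN normc_nat expr0 divr1 -natrX.
  have := sqr_sqrtc w; set s := sqrtc w => s2.
  have ns : normc s = 1.
    apply/eqP; rewrite -(@eqrXn2 _ 2) ?normc_ge0//.
    by rewrite -normcX s2 nw expr1n.
  have Res : 0 <= complex.Re s by rewrite /s; case: (w) => a b; exact: sqrtr_ge0.
  have sp : 2 <= normc (s + 1) ^+ 2.
    move: ns Res; case: (s) => a b /= ns a0.
    have : a ^+ 2 + b ^+ 2 = 1.
      by rewrite -(expr1n _ 2) -ns sqr_sqrtr// addr_ge0 ?sqr_ge0.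
    rewrite sqr_sqrtr ?addr_ge0 ?sqr_ge0// addr0 sqrrD1 => <-.
    by rewrite mulr2n; lra.
  exists (N * 2)%N, s; split => //.
  - by rewrite muln_gt0 N0.
  - by rewrite mulnC exprM s2.
  - by apply: contraNneq w1 => s1; rewrite -s2 s1 expr1n.
  have : normc (s - 1) ^+ 2 * normc (s + 1) ^+ 2 = normc (w - 1) ^+ 2.
    by rewrite -exprMn -normcM -s2; congr (normc _ ^+ _); ring.
  move=> H; have : 2 * normc (s - 1) ^+ 2 <= 4 / 2 ^+ m.
    by rewrite -H in Hw; apply: le_trans Hw; rewrite mulrC ler_wpM2l ?sqr_ge0.
  by move=> H2; rewrite [2 ^+ m.+1]exprSr invfM mulrA ler_pdivlMr// mulrC.
have [m Hm] : exists m, 4 / 2 ^+ m <= e ^+ 2.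
  pose m := Num.truncn (4 / e ^+ 2); exists m.
  rewrite ler_pdivrMr ?exprn_gt0// mulrC -ler_pdivrMr ?exprn_gt0//.
  apply: ltW; apply: (@lt_le_trans _ _ m.+1%:R); first exact: truncnS_gt.
  by rewrite -natrX ler_nat ltn_expl.
have [N [w [N0 wN w1 nw Hw]]] := step m; exists N, w; split => //.
by rewrite -(ler_pXn2r (n := 2)) ?nnegrE ?normc_ge0 ?(ltW e0)// (le_trans Hw).
Qed.

(** Discrete rotation invariance: the sum runs over a full cycle, so moving each
    sample point to the next one only multiplies it by w. *)
Lemma rotate_sum (N : nat) (w : R[i]) f z : (0 < N)%N -> w ^+ N = 1 ->
  \sum_(k < N) w ^- k * f (z * w ^+ k.+1) =
  w * \sum_(k < N) w ^- k * f (z * w ^+ k).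
Proof.
case: N => // N _ wN; have w0 : w != 0.
  by apply/eqP => w0; move/eqP: wN; rewrite w0 expr0n eq_sym oner_eq0.
rewrite big_ord_recr [in RHS]big_ord_recl /= wN mulrDr addrC; congr (_ + _).
  rewrite expr0 invr1 mul1r; congr (_ * _).
  by rewrite -[LHS]mulr1 -wN exprSr mulKf ?expf_neq0.
rewrite mulr_sumr; apply: eq_bigr => k _; rewrite /bump /= add1n mulrA.
by congr (_ * _); rewrite exprS invfM mulVKf.
Qed.

(** E(z) = sum_k w^-k f(z w^k) is, up to normalisation, a Riemann sum for the
    Cauchy integral of f'(0) over the circle of radius |z|.  Linearising f
    between neighbouring sample points, whose values cancel by rotation, shows
    that z E' - E is small, that is, E(z) / z is nearly constant on [rho, r].
    For small rho it is close to N f'(0), while at r it is at most N M / r. *)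
Lemma cauchy_estimate0 f df (r M : R) :
  (forall z, is_derive z (1:C) f (df z)) -> ccontinuous df -> 0 < r ->
  (forall w, normc w = r -> normc (f w) <= M) -> normc (df 0) <= M / r.
Proof.
move=> Hf dfc r0 HM; apply/ler_addgt0Pr => e' e'0.
pose e := e' / 2; have e0 : 0 < e by rewrite divr_gt0.
have /is_derive_epsP/(_ e e0)[d d0 Hd] := Hf 0.
pose rho := Num.min (d / 2) r.
have rho0 : 0 < rho by rewrite lt_min divr_gt0.
have rhor : rho <= r by rewrite ge_min lexx orbT.
have rhod : rho < d by rewrite gt_min ltr_pdivrMr// ltr_pMr// ltr1n.
(* then E(z) / (N z) varies by at most eta r / rho = e on [rho, r] *)
pose eta := e * rho / r; have eta0 : 0 < eta by rewrite divr_gt0// mulr_gt0.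
have [d1 d10 Hd1] := ccontinuous_unif dfc r eta0.
have [|N [w [N0 wN w1 nw Hw]]] := @fine_root_of_unity (d1 / r / 2).
  by rewrite !divr_gt0.
have w0 : w != 0 by rewrite -normc_eq0 nw oner_eq0.
have nwk k : normc (w ^+ k) = 1 by rewrite normcX nw expr1n.
have nwVk k : normc (w ^- k) = 1 by rewrite normcV nwk invr1.
pose E (z : C) : C := \sum_(k < N) w ^- k * f (z * w ^+ k).
pose dE (z : C) : C := \sum_(k < N) df (z * w ^+ k).
have HE z : is_derive z (1:C) E (dE z).
  have := @is_derive_sum C C C N (fun k z => w ^- k * f (z * w ^+ k)) z 1
     (fun k => df (z * w ^+ k)).
  rewrite /E /dE => H.
  have -> : (fun z => \sum_(k < N) w ^- k * f (z * w ^+ k)) =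
     \sum_(k < N) (fun z => w ^- k * f (z * w ^+ k)).
    by apply/funext => x; rewrite fct_sumE.
  apply: H => k.
  have -> : df (z * w ^+ k) = w ^- k * (df (z * w ^+ k + 0) * w ^+ k).
    by rewrite addr0 mulrCA mulVf ?mulr1 ?expf_neq0.
  apply: is_derive_scale.
  have := @is_derive_affine R f z 0 (w ^+ k) _ (Hf _).
  by under eq_fun do rewrite addr0.
(* E is nearly homogeneous of degree 1 *)
have Ehom z : normc z <= r -> normc (z * dE z - E z) <= N%:R * eta * normc z.
  move=> zr; have w10 : normc (w - 1) != 0 by rewrite normc_eq0 subr_eq0.
  rewrite -(ler_pM2r (x := normc (w - 1))) ?lt_def ?w10 ?normc_ge0//.
  rewrite -normcM -normcN.
  have -> : - ((z * dE z - E z) * (w - 1)) = \sum_(k < N) w ^- k *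
     (f (z * w ^+ k + z * w ^+ k * (w - 1)) - f (z * w ^+ k) -
      df (z * w ^+ k) * (z * w ^+ k * (w - 1))).
    have -> : - ((z * dE z - E z) * (w - 1)) =
      w * E z - E z - z * (w - 1) * dE z by ring.
    rewrite -(rotate_sum f z N0 wN) /E /dE mulr_sumr -!sumrB.
    apply: eq_bigr => k _.
    have -> : z * w ^+ k + z * w ^+ k * (w - 1) = z * w ^+ k.+1.
      by rewrite exprSr; ring.
    rewrite !mulrBr; congr (_ - _).
    have wk0 : w ^+ k != 0 by rewrite expf_neq0.
    by field.
  apply: le_trans (le_normc_sum _) _.
  have -> : N%:R * eta * normc z * normc (w - 1) =
     \sum_(k < N) eta * (normc z * normc (w - 1)).
    by rewrite sumr_const card_ord -mulr_natl; ring.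
  apply: ler_sum => k _; rewrite normcM nwVk mul1r.
  have -> : normc z * normc (w - 1) = normc (z * w ^+ k * (w - 1)).
    by rewrite !normcM nwk mulr1.
  apply: (linear_approx Hf) => s /andP[s0 s1]; apply: Hd1.
    by rewrite normcM nwk mulr1.
  rewrite addrAC subrr add0r !normcM nwk mulr1 normc_real ger0_norm//.
  apply: (@le_lt_trans _ _ (1 * (r * (d1 / r / 2)))).
    by rewrite ler_pM ?mulr_ge0 ?normc_ge0// ler_pM ?normc_ge0.
  have -> : 1 * (r * (d1 / r / 2)) = d1 / 2 by field; rewrite gt_eqF.
  by rewrite ltr_pdivrMr// ltr_pMr// ltr1n.
pose Q (z : C) : C := E z * z^-1.
pose dQ (z : C) : C := E z *: (- z ^- 2 *: 1) + z^-1 *: dE z.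
have HQ z : z != 0 -> is_derive z (1:C) Q (dQ z).
  move=> z0; apply: is_deriveM; split; first exact: derivableV.
  by rewrite deriveV// derive_id.
have Nr0 : 0 < N%:R :> R by rewrite ltr0n.
have HQr : normc (Q r%:C - Q rho%:C) <= N%:R * e.
  have -> : r%:C = rho%:C + (r - rho)%:C by rewrite -rmorphD /= addrC subrK.
  have HQ1 (s : R) : 0 <= s <= 1 ->
     exists2 t : R, rho <= t <= r & rho%:C + s%:C * (r - rho)%:C = t%:C.
    move=> /andP[s0 s1]; exists (rho + s * (r - rho)).
      rewrite lerDl mulr_ge0 ?subr_ge0//= -lerBrDl.
      by rewrite ler_piMl// subr_ge0.
    by rewrite [RHS]rmorphD rmorphM.
  apply: (@le_trans _ _ ((N%:R * (eta / rho)) * normc (r - rho)%:C)).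
    apply: (@mean_value_bound R Q dQ) => s /HQ1[t /andP[t1 t2] ->].
      by apply: HQ; rewrite -normc_gt0 normc_real gtr0_norm// (lt_le_trans rho0).
    have t0 : 0 < t by rewrite (lt_le_trans rho0).
    have tC0 : t%:C != 0 by rewrite -normc_gt0 normc_real gtr0_norm.
    have -> : dQ t%:C = t%:C ^- 2 * (t%:C * dE t%:C - E t%:C).
      by rewrite /dQ /GRing.scale /=; field.
    rewrite normcM normcV normcX normc_real gtr0_norm//.
    have := Ehom t%:C; rewrite normc_real gtr0_norm// => /(_ t2) H.
    apply: (@le_trans _ _ (t ^- 2 * (N%:R * eta * t))).
      by rewrite ler_wpM2l// invr_ge0 sqr_ge0.
    have -> : t ^- 2 * (N%:R * eta * t) = N%:R * (eta / t).
      by field; rewrite gt_eqF.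
    by rewrite ler_pM2l// ler_pM2l// lef_pV2.
  rewrite normc_real ger0_norm ?subr_ge0// -mulrA ler_pM2l//.
  apply: (@le_trans _ _ (eta / rho * r)).
    apply: ler_wpM2l; first by rewrite ltW// divr_gt0.
    by rewrite lerBlDr lerDl ltW.
  by rewrite /eta le_eqVlt; apply/orP; left; apply/eqP; field; rewrite !gt_eqF.
have HQrho : normc (Q rho%:C - N%:R * df 0) <= N%:R * e.
  have rC0 : rho%:C != 0 by rewrite -normc_gt0 normc_real gtr0_norm.
  have sum0 : \sum_(k < N) w ^- k = 0.
    have := rotate_sum (fun=> 1) 0 N0 wN; under eq_bigr do rewrite mulr1.
    move/eqP; rewrite -subr_eq0 -{1}[X in X - _]mul1r -mulrBl mulf_eq0.
    by rewrite subr_eq0 eq_sym (negbTE w1) => /eqP.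
  have -> : Q rho%:C - N%:R * df 0 = (rho%:C)^-1 * \sum_(k < N) w ^- k *
     (f (0 + rho%:C * w ^+ k) - f 0 - df 0 * (rho%:C * w ^+ k)).
    transitivity ((rho%:C)^-1 * (E rho%:C - \sum_(k < N) w ^- k * f 0 -
       \sum_(k < N) (df 0 * rho%:C))).
      rewrite -mulr_suml sum0 mul0r subr0 sumr_const card_ord -mulr_natl /Q.
      by field.
    congr (_ * _); rewrite /E -!sumrB; apply: eq_bigr => k _.
    rewrite add0r !mulrBr; congr (_ - _).
    by have wk0 : w ^+ k != 0; [rewrite expf_neq0|field].
  rewrite normcM normcV normc_real gtr0_norm// ler_pdivrMl//.
  apply: le_trans (le_normc_sum _) _.
  have -> : rho * (N%:R * e) = \sum_(k < N) e * rho.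
    by rewrite sumr_const card_ord -mulr_natl; ring.
  apply: ler_sum => k _; rewrite normcM nwVk mul1r.
  have rk : normc (rho%:C * w ^+ k) = rho.
    by rewrite normcM nwk mulr1 normc_real gtr0_norm.
  by have := Hd (rho%:C * w ^+ k); rewrite rk; apply.
have HQM : normc (Q r%:C) <= N%:R * (M / r).
  rewrite normcM normcV normc_real gtr0_norm// mulrA ler_pM2r ?invr_gt0//.
  apply: le_trans (le_normc_sum _) _.
  have -> : N%:R * M = \sum_(k < N) M by rewrite sumr_const card_ord mulr_natl.
  apply: ler_sum => k _; rewrite normcM nwVk mul1r; apply: HM.
  by rewrite normcM nwk mulr1 normc_real gtr0_norm.
rewrite -(ler_pM2l Nr0) -{1}(normc_nat N) -normcM.
have := normc_tri (N%:R * df 0) (Q rho%:C) 0; rewrite subr0 => /le_trans; apply.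
have := normc_tri (Q rho%:C) (Q r%:C) 0; rewrite !subr0 => H2.
have -> : N%:R * (M / r + e') = N%:R * e + (N%:R * e + N%:R * (M / r)).
  by rewrite /e; field; rewrite gt_eqF.
rewrite lerD// ?[normc (N%:R * _ - _)]normcB//; apply: le_trans H2 _.
by rewrite lerD// normcB.
Qed.

Lemma cauchy_estimate f df z (r M : R) :
  (forall z, is_derive z (1:C) f (df z)) -> ccontinuous df -> 0 < r ->
  (forall w, normc (w - z) = r -> normc (f w) <= M) -> normc (df z) <= M / r.
Proof.
move=> Hf dfc r0 HM; have := @cauchy_estimate0 (fun w => f (w + z))
   (fun w => df (w + z)) r M _ _ r0.
rewrite add0r; apply.
- by move=> w; apply: is_derive_shift.
- move=> w e e0; have [d d0 Hd] := dfc (w + z) e e0; exists d => // w' ww'.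
  by apply: Hd; rewrite opprD addrACA subrr addr0.
- by move=> w wr; apply: HM; rewrite addrK.
Qed.

End Cauchy.

(** * Derivatives of all orders and Taylor's formula *)

Section Smoothness.
Context {R : realType}.
Local Notation C := (Cplx R).
Implicit Types (f g df : C -> C) (z a b c d : C).

Lemma real_cauchy_cvg (u : nat -> R) :
  (forall e, 0 < e -> exists N, forall m n, (N <= m)%N -> (N <= n)%N ->
     `|u m - u n| <= e) ->
  exists l, forall e, 0 < e -> exists N, forall n, (N <= n)%N -> `|u n - l| <= e.
Proof.
move=> H; have : cvg (u @ \oo).
  apply/cauchy_cvgP/cauchy_exP => e e0; have [|N HN] := H (e / 2).
    by rewrite divr_gt0.
  exists (u N); exists N => // n /= Nn; rewrite /ball /=.
  apply: le_lt_trans (HN _ _ (leqnn N) Nn) _.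
  by rewrite ltr_pdivrMr// ltr_pMr// ltr1n.
move=> /cvg_ex[l /cvgrPdist_le ul]; exists l => e e0.
have [N _ HN] := ul e e0; exists N => n Nn; rewrite distrC.
exact: HN.
Qed.

Lemma complex_cauchy_cvg (u : nat -> R[i]) :
  (forall e, 0 < e -> exists N, forall m n, (N <= m)%N -> (N <= n)%N ->
     normc (u m - u n) <= e) ->
  exists l, forall e, 0 < e ->
    exists N, forall n, (N <= n)%N -> normc (u n - l) <= e.
Proof.
move=> H.
have ReB (x y : R[i]) : complex.Re x - complex.Re y = complex.Re (x - y).
  by case: x y => ? ? [].
have ImB (x y : R[i]) : complex.Im x - complex.Im y = complex.Im (x - y).
  by case: x y => ? ? [].
have [|a Ha] := @real_cauchy_cvg (fun n => complex.Re (u n)).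
  move=> e /H[N HN]; exists N => m n Nm Nn.
  by rewrite ReB (le_trans (Re_abs_le_normc _))// HN.
have [|b Hb] := @real_cauchy_cvg (fun n => complex.Im (u n)).
  move=> e /H[N HN]; exists N => m n Nm Nn.
  by rewrite ImB (le_trans (Im_abs_le_normc _))// HN.
exists (a +i* b) => e e0; have e20 : 0 < e / 2 by rewrite divr_gt0.
have [N HN] := Ha _ e20; have [M HM] := Hb _ e20.
exists (maxn N M) => n; rewrite geq_max => /andP[Nn Mn].
have := HN n Nn; have := HM n Mn; case: (u n) => x y /= yb xa.
change (normc ((x - a) +i* (y - b) : R[i]) <= e).
by rewrite (le_trans (normc_le_abs _ _))// (splitr e) lerD.
Qed.

(** The difference quotients of f converge to f' locally uniformly; Cauchy's
    estimate, applied to the difference of two of them, shows that their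
    derivatives, which are the difference quotients of f', converge as well. *)
Lemma derivative_is_C1 f df : (forall z, is_derive z (1:C) f (df z)) ->
  ccontinuous df ->
  exists ddf, (forall z, is_derive z (1:C) df (ddf z)) /\ ccontinuous ddf.
Proof.
move=> Hf dfc.
pose dq (h z : C) : C := h^-1 * (df (z + h) - df z).
have Hq r e : 0 < e -> exists2 d, 0 < d & forall z h k, normc z <= r ->
    h != 0 -> k != 0 -> normc h < d -> normc k < d ->
    normc (dq h z - dq k z) <= e.
  move=> e0; have e20 : 0 < e / 2 by rewrite divr_gt0.
  have [d d0 Hd] := ccontinuous_unif dfc (r + 1) e20.
  exists d => // z h k zr h0 k0 hd kd.
  have app w h' : normc (w - z) = 1 -> h' != 0 -> normc h' < d ->
      normc (h'^-1 * (f (w + h') - f w) - df w) <= e / 2.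
    move=> wz h'0 h'd; have n0 : 0 < normc h' by rewrite normc_gt0.
    rewrite -(ler_pM2l n0) -normcM mulrBr mulVKf//.
    rewrite [h' * _]mulrC [leRHS]mulrC; apply: (linear_approx Hf).
    move=> s /andP[s0 s1]; apply: Hd.
      by have := normc_tri w z 0; rewrite !subr0 wz => /le_trans; apply;
        rewrite addrC lerD2r.
    rewrite addrAC subrr add0r normcM normc_real ger0_norm//.
    by apply: le_lt_trans h'd; rewrite ler_piMl ?normc_ge0.
  have dqd h' w : is_derive w (1:C) (fun w => h'^-1 * (f (w + h') - f w))
      (dq h' w).
    exact: (is_derive_scale _ (is_derive_sub (is_derive_shift (Hf _)) (Hf w))).
  pose g (w : C) : C := h^-1 * (f (w + h) - f w) - k^-1 * (f (w + k) - f w).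
  pose dg (w : C) : C := dq h w - dq k w.
  suff [H1 H2 H3] : [/\ forall w, is_derive w (1:C) g (dg w), ccontinuous dg &
      forall w, normc (w - z) = 1 -> normc (g w) <= e].
    by have := cauchy_estimate H1 H2 ltr01 H3; rewrite divr1.
  split.
  - by move=> w; exact: (is_derive_sub (dqd h w) (dqd k w)).
  - move=> w e' e'0.
    have e'' : 0 < e' / (2 * (normc h^-1 + normc k^-1)).
      by rewrite !divr_gt0// mulr_gt0// addr_gt0// normc_gt0 invr_eq0.
    have cs := dfc w _ e''; have ch := dfc (w + h) _ e''.
    have ck := dfc (w + k) _ e''.
    case: cs => ds ds0 Hs; case: ch => dh dh0 Hh; case: ck => dk dk0 Hk.
    exists (Num.min ds (Num.min dh dk)); first by rewrite !lt_min ds0 dh0.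
    move=> w'; rewrite !lt_min => /and3P[ws wh wk].
    have Edg : dg w' - dg w =
      h^-1 * (df (w' + h) - df (w + h) - (df w' - df w)) -
      k^-1 * (df (w' + k) - df (w + k) - (df w' - df w)).
      by rewrite /dg /dq; ring.
    rewrite Edg.
    apply: le_trans (le_normcB _ _) _; rewrite !normcM.
    set E := e' / _ in e'' Hs Hh Hk.
    have Eh : normc (df (w' + h) - df (w + h) - (df w' - df w)) <= 2 * E.
      rewrite (le_trans (le_normcB _ _))// mulr_natl mulr2n lerD ?Hs// Hh//.
      by rewrite opprD addrACA subrr addr0.
    have Ek : normc (df (w' + k) - df (w + k) - (df w' - df w)) <= 2 * E.
      rewrite (le_trans (le_normcB _ _))// mulr_natl mulr2n lerD ?Hs// Hk//.
      by rewrite opprD addrACA subrr addr0.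
    apply: (@le_trans _ _ ((normc h^-1 + normc k^-1) * (2 * E))).
      by rewrite mulrDl lerD// ler_wpM2l// normc_ge0.
    rewrite le_eqVlt; apply/orP; left; apply/eqP; rewrite /E; field.
    by rewrite gt_eqF// addr_gt0// normc_gt0 invr_eq0.
  - move=> w wz; rewrite (splitr e).
    apply: le_trans (normc_tri _ (df w) _) _.
    by rewrite lerD// ?[normc (df w - _)]normcB; apply: app.
pose h_ n : R[i] := (n.+1%:R^-1)%:C.
have h_neq0 n : h_ n != 0.
  by rewrite -normc_gt0 normc_real gtr0_norm invr_gt0 ltr0n.
have h_small (d : R) : 0 < d -> exists N, forall n, (N <= n)%N -> normc (h_ n) < d.
  move=> d0; exists (Num.truncn d^-1) => n Nn.
  rewrite normc_real gtr0_norm ?invr_gt0 ?ltr0n// -[ltRHS]invrK.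
  rewrite ltf_pV2 ?posrE ?invr_gt0 ?ltr0n//.
  by apply: lt_le_trans (truncnS_gt _) _; rewrite ler_nat.
have lim_ex z : exists l, forall e, 0 < e -> exists N, forall n, (N <= n)%N ->
    normc (dq (h_ n) z - l) <= e.
  apply: complex_cauchy_cvg => e e0; have [d d0 Hd] := Hq (normc z) e e0.
  have [N HN] := h_small d d0; exists N => m n Nm Nn.
  by apply: Hd => //; exact: HN.
have [ddf Hddf] := choice lim_ex.
have Hlim r e : 0 < e -> exists2 d, 0 < d & forall z h, normc z <= r ->
    h != 0 -> normc h < d -> normc (dq h z - ddf z) <= e.
  move=> e0; have e20 : 0 < e / 2 by rewrite divr_gt0.
  have [d d0 Hd] := Hq r _ e20; exists d => // z h zr h0 hd.
  have [N HN] := Hddf z _ e20; have [M HM] := h_small d d0.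
  rewrite (splitr e); apply: le_trans (normc_tri _ (dq (h_ (maxn N M)) z) _) _.
  rewrite lerD//; first by apply: Hd => //; apply: HM; rewrite leq_maxr.
  by apply: HN; rewrite leq_maxl.
have Hdf z : is_derive z (1:C) df (ddf z).
  apply/is_derive_epsP => e e0; have [d d0 Hd] := Hlim (normc z) e e0.
  exists d => // w wd; have [->|w0] := eqVneq w 0.
    by rewrite addr0 subrr mulr0 subr0 normc0 mulr0.
  have := Hd z w (lexx _) w0 wd.
  rewrite -(ler_pM2r (x := normc w)) ?normc_gt0// -normcM mulrBl.
  by rewrite /dq mulrAC mulVf// mul1r.
exists ddf; split=> // z e e0.
have e30 : 0 < e / 3 by rewrite divr_gt0.
have [d d0 Hd] := Hlim (normc z + 1) _ e30.
have [N HN] := h_small d d0; set h := h_ N.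
have hd : normc h < d by exact: HN.
have h0 : h != 0 := h_neq0 N.
have E0 : 0 < e / 6 * normc h by rewrite mulr_gt0 ?normc_gt0// divr_gt0.
have [d1 d10 Hd1] := dfc z _ E0; have [d2 d20 Hd2] := dfc (z + h) _ E0.
exists (Num.min 1 (Num.min d1 d2)); first by rewrite !lt_min ltr01 d10.
move=> w; rewrite !lt_min => /and3P[w1 wd1 wd2].
have wr : normc w <= normc z + 1.
  have := normc_tri w z 0; rewrite !subr0 => /le_trans; apply.
  by rewrite addrC lerD2l ltW.
have -> : e = e / 3 + (e / 3 + e / 3) by field.
apply: le_trans (normc_tri _ (dq h w) _) _.
rewrite lerD//; first by rewrite normcB; apply: Hd.
apply: le_trans (normc_tri _ (dq h z) _) _.
rewrite lerD//; last by apply: Hd => //; rewrite lerDl.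
rewrite /dq -mulrBr normcM normcV ler_pdivrMl ?normc_gt0//.
have -> : df (w + h) - df w - (df (z + h) - df z) =
  df (w + h) - df (z + h) - (df w - df z) by ring.
apply: le_trans (le_normcB _ _) _.
have -> : normc h * (e / 3) = e / 6 * normc h + e / 6 * normc h by field.
by rewrite lerD ?Hd1 ?Hd2// opprD addrACA subrr addr0.
Qed.

(** Continuity of the derivative is included because Cauchy's estimate starts
    from it. *)
Definition entire f :=
  (forall z, derivable f z (1:C)) /\ ccontinuous ('D_(1:C) f).

Lemma entire_is_derive f z : entire f -> is_derive z (1:C) f ('D_(1:C) f z).
Proof. by case=> /(_ z) fd _; exact: derivableP. Qed.

Lemma entire_of_is_derive f df : (forall z, is_derive z (1:C) f (df z)) ->
  ccontinuous df -> entire f /\ 'D_(1:C) f = df.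
Proof.
move=> Hf dfc; have E : 'D_(1:C) f = df.
  by apply/funext => z; have [_] := Hf z.
by split=> //; split; [move=> z; have [] := Hf z | rewrite E].
Qed.

Lemma entire_derive f : entire f -> entire ('D_(1:C) f).
Proof.
move=> fe; have [ddf [H1 H2]] :=
  derivative_is_C1 (fun z => entire_is_derive z fe) fe.2.
by have [] := entire_of_is_derive H1 H2.
Qed.

Definition nderive n f : C -> C := iter n (fun g => 'D_(1:C) g) f.

#[global] Arguments nderive : simpl never.

Lemma nderiveSr n f : nderive n.+1 f = nderive n ('D_(1:C) f).
Proof. exact: iterSr. Qed.

Lemma entire_nderive n f : entire f -> entire (nderive n f).
Proof.
by move=> fe; elim: n => [|n IH]; [exact: fe|exact: (entire_derive IH)].
Qed.

Lemma entire_ccontinuous f : entire f -> ccontinuous f.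
Proof.
by move=> fe; apply: is_derive_ccontinuous => z; exact: entire_is_derive.
Qed.

Lemma entire_cauchy f z (r M : R) : entire f -> 0 < r ->
  (forall w, normc (w - z) = r -> normc (f w) <= M) ->
  normc ('D_(1:C) f z) <= M / r.
Proof.
move=> fe; apply: cauchy_estimate fe.2.
by move=> w; exact: entire_is_derive.
Qed.

(** n applications of Cauchy's estimate on circles of radius h.  Compared with
    the sharp estimate this loses a factor e^n, to which the order is blind. *)
Lemma nderive_cauchy n f z (h M : R) : entire f -> 0 < h ->
  (forall w, normc (w - z) <= n%:R * h -> normc (f w) <= M) ->
  normc (nderive n f z) <= M / h ^+ n.
Proof.
move=> fe h0; elim: n z => [|n IH] z HM.
  by rewrite expr0 divr1; apply: HM; rewrite subrr normc0 mul0r.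
rewrite exprSr invfM mulrA.
apply: (entire_cauchy (entire_nderive n fe) h0).
move=> w wz; apply: IH => x xw; apply: HM.
apply: le_trans (normc_tri _ w _) _.
by rewrite wz -natr1 mulrDl mul1r lerD2r.
Qed.

Definition taylor m f a z : C :=
  \sum_(k < m) nderive k f a * ((z - a) ^+ k / k`!%:R).

Lemma is_derive_expr_sub k a z :
  is_derive z (1:C) (fun w => (w - a) ^+ k : C) (k%:R * (z - a) ^+ k.-1).
Proof.
have H : is_derive z (1:C) (fun w : C => w - a : C) (1:C).
  have := is_derive_sub (is_derive_id z (1:C)) (is_derive_cst a z (1:C)).
  by rewrite subr0.
have := is_deriveX k H; rewrite /GRing.scale /= mulr1.
suff -> : (fun w : C => w - a : C) ^+ k = (fun w => (w - a) ^+ k : C) by [].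
by apply/funext => w; rewrite exprfctE.
Qed.

Lemma is_derive_taylor m f a z :
  is_derive z (1:C) (taylor m.+1 f a) (taylor m ('D_(1:C) f) a z).
Proof.
have -> : taylor m.+1 f a = \sum_(k < m.+1)
    (fun z => nderive k f a * ((z - a) ^+ k / k`!%:R)) :> (C -> C).
  by apply/funext => x; rewrite fct_sumE.
have -> : taylor m ('D_(1:C) f) a z = \sum_(k < m.+1)
    nderive k f a * ((k%:R * (z - a) ^+ k.-1) / k`!%:R).
  rewrite big_ord_recl /= !mul0r mulr0 add0r; apply: eq_bigr => k _.
  rewrite /bump /= add1n nderiveSr; congr (_ * _).
  by rewrite factS natrM invfM mulrACA divff ?pnatr_eq0// mul1r.
apply: is_derive_sum => k; apply: is_derive_scale.
under eq_fun do rewrite mulrC; rewrite mulrC.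
apply: is_derive_scale.
exact: is_derive_expr_sub.
Qed.

(** Induction on m: the derivative of the remainder of f is the remainder of f'.
    Times |v|, the latter is at most S |v|^(m+1) s^m / m! at a + s v, and this
    has the primitive S |v|^(m+1) s^(m+1) / (m+1)!. *)
Lemma taylor_remainder m f a z (S : R) : entire f ->
  (forall w, normc (w - a) <= normc (z - a) -> normc (nderive m f w) <= S) ->
  normc (f z - taylor m f a z) <= S * normc (z - a) ^+ m / m`!%:R.
Proof.
move=> fe; elim: m f fe z => [|m IH] f fe z HS.
  by rewrite /taylor big_ord0 subr0 expr0 mulr1 divr1; apply: HS.
set v := z - a; have zv : z = a + v by rewrite /v addrC subrK.
pose g w := f w - taylor m.+1 f a w.
have ga : g a = 0.
  rewrite /g /taylor big_ord_recl big1 => [|k _].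
    by rewrite /= expr0 fact0 divr1 mulr1 addr0 subrr.
  by rewrite subrr expr0n mul0r mulr0.
have -> : f z - taylor m.+1 f a z = g (a + v) - g a by rewrite ga subr0 -zv.
have := @mean_value_majorant R g
  (fun w => 'D_(1:C) f w - taylor m ('D_(1:C) f) a w)
  (fun s => (S * normc v ^+ m.+1 / m.+1`!%:R) * s ^+ m.+1)
  (fun s => (S * normc v ^+ m.+1 / m`!%:R) * s ^+ m) a v.
rewrite expr1n mulr1 expr0n mulr0 subr0; apply.
- move=> s _; apply: is_derive_sub; [exact: entire_is_derive |].
  exact: is_derive_taylor.
- move=> s _.
  have Hs : is_derive s (1:R) (fun s : R => s ^+ m.+1) (m.+1%:R * s ^+ m).
    split; first exact: exprn_derivable.
    by rewrite exp_derive /GRing.scale /= mulr1.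
  have := is_deriveZ (S * normc v ^+ m.+1 / m.+1`!%:R) Hs.
  rewrite /GRing.scale /=.
  have -> // : S * normc v ^+ m.+1 / m.+1`!%:R * (m.+1%:R * s ^+ m) =
     S * normc v ^+ m.+1 / m`!%:R * s ^+ m.
  have m0 : m.+1%:R != 0 :> R by rewrite pnatr_eq0.
  have f0 : m`!%:R != 0 :> R by rewrite pnatr_eq0 -lt0n fact_gt0.
  rewrite factS natrM; move: (m.+1%:R) m0 (m`!%:R) f0 => A A0 B B0.
  by field; rewrite A0 B0.
- move=> s /andP[s0 s1]; have nsv : normc (a + s%:C * v - a) = s * normc v.
    by rewrite addrAC subrr add0r normcM normc_real ger0_norm.
  rewrite normcM.
  have -> : S * normc v ^+ m.+1 / m`!%:R * s ^+ m =
     (S * (s * normc v) ^+ m / m`!%:R) * normc v.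
    by rewrite exprSr exprMn; ring.
  apply: ler_wpM2r; first exact: normc_ge0.
  rewrite -nsv; apply: (IH _ (entire_derive fe)) => w wa.
  rewrite -nderiveSr; apply: HS; apply: le_trans wa _.
  by rewrite nsv ler_piMl ?normc_ge0.
Qed.

End Smoothness.

(** * Growth of a function and of its derivatives *)

Section Growth.
Context {R : realType}.
Local Notation C := (Cplx R).
Implicit Types (f g : C -> C) (z w a : C).

Lemma max_modulus_ge f w : ccontinuous f ->
  normc (f w) <= max_modulus f (normc w).
Proof.
move=> fc; have [M HM] := ccontinuous_bounded fc (normc w).
apply: ub_le_sup; last by exists w.
by exists M => _ [x /= xw <-]; apply: HM; rewrite xw.
Qed.

Lemma max_modulus_le f (r M : R) : 0 <= r ->
  (forall w, normc w = r -> normc (f w) <= M) -> max_modulus f r <= M.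
Proof.
move=> r0 HM; apply: ge_sup.
  exists (normc (f r%:C)); exists r%:C => //.
  by change (normc r%:C = r); rewrite normc_real ger0_norm.
by move=> _ [x /= xr <-]; exact: HM.
Qed.

(** Here exp (s ln x) stands for x^s: keeping all bounds exponential makes the
    later comparisons linear in the exponents.  The constant K absorbs the small
    circles, on which the order says nothing. *)
Lemma order_lt_bound f (s : R) : ccontinuous f -> 0 < s ->
  (entire_order f < s%:E)%E -> exists K : R, forall x w, 1 <= x ->
    normc w <= x -> normc (f w) <= expR (K + expR (s * ln x)).
Proof.
move=> fc s0; rewrite /entire_order /limf_esup.
move=> /ereal_inf_lt[_ [V [A [_ HA]] <-] Vs].
have HV x : A < x -> ln (ln (max_modulus f x)) / ln x < s.
  move=> /HA Vx; rewrite -lte_fin; apply: le_lt_trans Vs.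
  by apply: ereal_sup_ubound; exists x.
pose B := Num.max 1 A.
have [M HM] := ccontinuous_bounded fc B.
exists (ln (Num.max 1 M)) => x w x1 wx.
have K1 : 1 <= Num.max 1 M by rewrite le_max lexx.
have lK : 0 <= ln (Num.max 1 M) by rewrite ln_ge0.
have [wB|wB] := leP (normc w) B.
  apply: le_trans (HM w wB) _; apply: (@le_trans _ _ (Num.max 1 M)).
    by rewrite le_max lexx orbT.
  rewrite -[leLHS]lnK ?posrE ?(lt_le_trans ltr01)// ler_expR lerDl.
  exact: expR_ge0.
apply: le_trans (max_modulus_ge w fc) _.
move: wB; rewrite gt_max => /andP[w1 wA].
have lw : 0 < ln (normc w) by rewrite ln_gt0.
have := HV _ wA; rewrite ltr_pdivrMr// => Hw.
set m := max_modulus f (normc w) in Hw *.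
have [m1|m1] := leP m 1.
  by rewrite (le_trans m1)// -[leLHS]expR0 ler_expR addr_ge0 ?expR_ge0.
have m0 : 0 < m by rewrite (lt_trans ltr01).
have lm0 : 0 < ln m by rewrite ln_gt0.
rewrite -[leLHS]lnK ?posrE// ler_expR -[leLHS]add0r lerD//.
rewrite -[leLHS]lnK ?posrE// ler_expR (le_trans (ltW Hw))// ler_wpM2l ?(ltW s0)//.
by rewrite ler_ln ?posrE ?(lt_trans ltr01 w1) ?(lt_le_trans ltr01 x1).
Qed.

Lemma expR_ln_nat n : expR (ln n%:R : R) <= n.+1%:R.
Proof.
case: n => [|n]; last by rewrite lnK ?posrE ?ltr0n// ler_nat.
by rewrite ln0 // expR0.
Qed.

(** Iterated Cauchy estimates with total radius rho = n^(1/s), the choice that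
    balances the bound exp (rho^s) on f against the factor h^-n.  Uniformity of
    the constant over discs serves to bound Taylor remainders. *)
Lemma derivative_growth f (s : R) : entire f -> 0 < s ->
  (entire_order f < s%:E)%E -> forall r : R, exists D : R, forall a n,
    normc a <= r ->
    normc (nderive n f a) <=
      expR (D * n.+1%:R + (1 - s^-1) * (n%:R * ln n%:R)).
Proof.
move=> fe s0 fs r.
have [K HK] := order_lt_bound (entire_ccontinuous fe) s0 fs.
pose r' := Num.max 0 r.
pose e1 := expR (s * ln (1 + r')).
have r'0 : 0 <= r' by rewrite le_max lexx.
exists (`|K| + e1) => a n ar; have ar' : normc a <= r' by rewrite le_max ar orbT.
(* n h = rho; since [ln 0 = 0], the formulas are sound for n = 0 as well *)
pose h := expR (ln n%:R / s - ln n%:R : R).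
pose rho := expR (ln n%:R / s : R).
have rho1 : 1 <= rho.
  rewrite -expR0 ler_expR divr_ge0 ?(ltW s0)//.
  by case: n {h rho} => [|n]; [rewrite ln0|rewrite ln_ge0// ler1n].
have nh : n%:R * h <= rho.
  rewrite /h expRB mulrCA ler_piMr ?expR_ge0//.
  by case: n {h rho rho1} => [|n]; rewrite ?mul0r// lnK ?posrE ?ltr0n// divff.
pose M := expR (`|K| + e1 * n.+1%:R).
have := @nderive_cauchy R n f a h M fe (expR_gt0 _).
have -> : M / h ^+ n = expR (`|K| + e1 * n.+1%:R +
   (1 - s^-1) * (n%:R * ln n%:R)).
  by rewrite -expRM_natl -expRB; congr expR; ring.
move=> H; apply: (le_trans (H _)); last first.
  rewrite ler_expR lerD2r mulrDl lerD2r ler_peMr ?normr_ge0//.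
  by rewrite ler1n.
move=> w wa; have x1 : 1 <= (1 + r') * rho.
  by rewrite mulr_ege1// lerDl.
apply: (le_trans (HK _ w x1 _)).
  have := normc_tri w a 0; rewrite !subr0 => /le_trans; apply.
  rewrite mulrDl mul1r; apply: lerD; first exact: (le_trans wa).
  by rewrite (le_trans ar')// ler_peMr.
rewrite ler_expR lerD ?ler_norm// lnM ?posrE ?expR_gt0 ?ltr_wpDr//.
rewrite mulrDr expRD expRK mulrCA divff ?gt_eqF// mulr1.
by rewrite ler_wpM2l ?expR_ge0// expR_ln_nat.
Qed.

(** From (1 + 1/k)^k <= e by induction. *)
Lemma natr_expn_le k : k%:R ^+ k <= expR k%:R * k`!%:R :> R.
Proof.
elim: k => [|k IH]; first by rewrite expr0 expR0 mul1r.
have step : k.+1%:R ^+ k <= expR 1 * k%:R ^+ k :> R.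
  case: k {IH} => [|k].
    by rewrite !expr0 mulr1 (le_trans _ (expR_ge1Dx 1))// lerDl.
  have k0 : 0 < k.+1%:R :> R by rewrite ltr0n.
  have -> : k.+2%:R = (1 + k.+1%:R^-1) * k.+1%:R :> R.
    by rewrite mulrDl mul1r mulVf ?gt_eqF// natr1.
  rewrite exprMn ler_pM2r ?exprn_gt0//.
  apply: (@le_trans _ _ (expR k.+1%:R^-1 ^+ k.+1)).
    by rewrite lerXn2r ?nnegrE ?expR_ge0 ?expR_ge1Dx// addr_ge0.
  by rewrite -expRM_natl divff ?gt_eqF.
rewrite exprS factS natrM mulrCA ler_wpM2l ?ler0n//.
apply: (le_trans step); rewrite -[k.+1]add1n natrD expRD -mulrA.
by rewrite ler_wpM2l ?expR_ge0.
Qed.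

(** The lower half of Stirling's formula. *)
Lemma fact_lower n : expR (n%:R * ln n%:R - n%:R : R) <= n`!%:R.
Proof.
rewrite expRB ler_pdivrMr ?expR_gt0// [leRHS]mulrC.
apply: le_trans (natr_expn_le n).
case: n => [|n]; first by rewrite mul0r expR0.
by rewrite expRM_natl lnK ?posrE ?ltr0n.
Qed.

(** Cauchy's estimate on circles of total radius rho = 2 e t bounds the k-th
    Taylor remainder by M / 2^k, because k^k / k! <= e^k. *)
Lemma taylor_cvg f a w (B : R) : entire f ->
  (forall m, normc (taylor m f a w) <= B) -> normc (f w) <= B.
Proof.
move=> fe HB; apply/ler_addgt0Pr => e e0.
pose t := normc (w - a) + 1.
have t0 : 0 < t by rewrite ltr_wpDl// normc_ge0.
pose rho := t * (2 * expR 1).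
have rho0 : 0 < rho by rewrite !mulr_gt0// expR_gt0.
have [M0 HM0] := ccontinuous_bounded (entire_ccontinuous fe)
  (normc a + t + rho).
pose M := Num.max 1 M0.
have M1 : 0 < M by rewrite lt_max ltr01.
have [m Hm] : exists m, M / 2 ^+ m.+1 <= e.
  pose m := Num.truncn (M / e); exists m.
  rewrite ler_pdivrMr ?exprn_gt0// mulrC -ler_pdivrMr//.
  apply: ltW; apply: (@lt_le_trans _ _ m.+1%:R); first exact: truncnS_gt.
  by rewrite -natrX ler_nat ltnW// ltn_expl.
set k := m.+1 in Hm.
pose h := rho / k%:R.
have k0 : 0 < k%:R :> R by rewrite ltr0n.
have h0 : 0 < h by rewrite divr_gt0.
have Hrem : normc (f w - taylor k f a w) <=
    (M / h ^+ k) * normc (w - a) ^+ k / k`!%:R.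
  apply: taylor_remainder => // w' w'a.
  apply: nderive_cauchy => // x xw'.
  apply: (@le_trans _ _ M0); last by rewrite le_max lexx orbT.
  apply: HM0; have := normc_tri x w' 0; rewrite !subr0 => /le_trans; apply.
  rewrite addrC; apply: lerD; last first.
    by rewrite (le_trans xw')// /h mulrC divfK ?gt_eqF.
  have := normc_tri w' a 0; rewrite !subr0 => /le_trans; apply.
  by rewrite addrC lerD2l (le_trans w'a)// lerDl.
have Hrem2 : (M / h ^+ k) * normc (w - a) ^+ k / k`!%:R <= e.
  apply: le_trans Hm.
  apply: (@le_trans _ _ (M / h ^+ k * t ^+ k / k`!%:R)).
    rewrite ler_wpM2r ?invr_ge0// ler_wpM2l//.
      by rewrite divr_ge0 ?exprn_ge0 ?(ltW h0) ?(ltW M1).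
    by rewrite lerXn2r ?nnegrE ?normc_ge0 ?(ltW t0)// lerDl.
  have f0 : 0 < k`!%:R :> R by rewrite ltr0n fact_gt0.
  rewrite -!mulrA ler_pM2l//.
  have -> : (h ^+ k)^-1 * (t ^+ k / k`!%:R) =
      (2 ^+ k)^-1 * ((k%:R / expR 1) ^+ k / k`!%:R).
    rewrite [LHS]mulrA [RHS]mulrA -!exprVn -!exprMn.
    congr (_ ^+ _ * _); rewrite /h /rho; field.
    by rewrite !gt_eqF ?expR_gt0.
  rewrite ler_piMr ?invr_ge0 ?exprn_ge0// ler_pdivrMr// mul1r.
  apply: le_trans (fact_lower k); rewrite expRB expRM_natl lnK ?posrE//.
  by rewrite exprMn exprVn -expRM_natl mulr1.
have := normc_tri (f w) (taylor k f a w) 0; rewrite !subr0 => /le_trans; apply.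
by rewrite addrC lerD// (le_trans Hrem).
Qed.

Lemma sum_expRN m : \sum_(k < m) expR (- k%:R : R) <= 2.
Proof.
suff : \sum_(k < m) expR (- k%:R : R) <= 2 - 2 / 2 ^+ m.
  by move=> /le_trans; apply; rewrite lerBlDr lerDl divr_ge0// exprn_ge0.
elim: m => [|m IH]; first by rewrite big_ord0 expr0 divr1 subrr.
have Hm : expR (- m%:R) <= (2 ^+ m)^-1 :> R.
  rewrite expRN -[m%:R]mulr1 expRM_natl lef_pV2 ?posrE ?exprn_gt0 ?expR_gt0//.
  apply: (@lerXn2r R m 2 (expR 1)); rewrite ?nnegrE ?expR_ge0//.
  by have := expR_ge1Dx (1 : R); rewrite -mulr2n.
rewrite big_ord_recr /=; apply: le_trans (lerD IH Hm) _.
have m0 : (2 ^+ m : R) != 0 by rewrite expf_neq0.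
by rewrite exprS le_eqVlt; apply/orP; left; apply/eqP; field.
Qed.

(** This is y <= exp y for y = s L - ln x. *)
Lemma mul_le_expR (x L s : R) : 0 <= x -> 0 < s ->
  x * (L - ln x / s) <= expR (s * L) / s.
Proof.
move=> x0 s0; have [->|xn0] := eqVneq x 0.
  by rewrite mul0r divr_ge0 ?expR_ge0 ?(ltW s0).
have xp : 0 < x by rewrite lt_def xn0.
rewrite ler_pdivlMr//; pose y := s * L - ln x.
have -> : x * (L - ln x / s) * s = x * y by rewrite /y; field; rewrite gt_eqF.
have -> : expR (s * L) = x * expR y.
  by rewrite -{1}[x]lnK ?posrE// -expRD /y addrC subrK.
rewrite ler_pM2l//; apply: le_trans (expR_ge1Dx y); by rewrite lerDr.
Qed.

(** The Taylor series is controlled by its largest term: a factor e^-k is set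
    aside for summation, and [mul_le_expR] bounds what remains. *)
Lemma growth_bound f a (s D : R) : entire f -> 0 < s ->
  (forall n, normc (nderive n f a) <=
      expR (D * n.+1%:R + (1 - s^-1) * (n%:R * ln n%:R))) ->
  forall t w, 1 <= t -> normc (w - a) <= t ->
    normc (f w) <= expR (D + 1 + expR (s * (D + 2)) / s * expR (s * ln t)).
Proof.
move=> fe s0 HD t w t1 wt; apply: (taylor_cvg fe) => m.
have t0 : 0 < t by rewrite (lt_le_trans ltr01).
pose L := D + 2 + ln t.
have -> : expR (D + 1 + expR (s * (D + 2)) / s * expR (s * ln t)) =
  expR (D + expR (s * L) / s) * expR 1.
  have sL : s * L = s * (D + 2) + s * ln t by rewrite /L mulrDr.
  by rewrite -expRD sL (expRD (s * (D + 2))); congr expR; ring.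
apply: (@le_trans _ _ (expR (D + expR (s * L) / s) *
   \sum_(k < m) expR (- k%:R))); last first.
  rewrite ler_wpM2l ?expR_ge0// (le_trans (sum_expRN m))//.
  exact: (le_trans _ (expR_ge1Dx 1)).
rewrite mulr_sumr; apply: le_trans (le_normc_sum _) _; apply: ler_sum => k _.
rewrite !normcM normcX normcV normc_nat.
have f0 : 0 < (k`!)%:R :> R by rewrite ltr0n fact_gt0.
apply: (@le_trans _ _ (expR (D * k.+1%:R + (1 - s^-1) * (k%:R * ln k%:R)) *
  (expR (k%:R * ln t) / expR (k%:R * ln k%:R - k%:R)))).
  apply: ler_pM; rewrite ?normc_ge0// ?divr_ge0 ?exprn_ge0 ?normc_ge0//.
  rewrite expRM_natl lnK ?posrE// ler_pM ?invr_ge0 ?exprn_ge0 ?normc_ge0//.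
    by rewrite lerXn2r ?nnegrE ?normc_ge0 ?(ltW t0).
  by rewrite lef_pV2 ?posrE ?expR_gt0// fact_lower.
rewrite -expRB -!expRD ler_expR.
have := @mul_le_expR k%:R L s (ler0n _ _) s0.
rewrite /L; move: (expR _ / s) => X HX.
rewrite -subr_ge0 in HX; rewrite -subr_ge0; move: HX; congr (0 <= _).
by rewrite -natr1; field; rewrite gt_eqF.
Qed.
End Growth.

(** * Bounds on the order *)

Section Order.
Context {R : realType}.
Local Notation C := (Cplx R).
Implicit Types (f g : C -> C) (z w a : C).

Lemma order_le f (l : R) : (forall e : R, 0 < e -> exists A : R,
    forall x, A < x -> ln (ln (max_modulus f x)) / ln x <= l + e) ->
  (entire_order f <= l%:E)%E.
Proof.
move=> H; apply/lee_addgt0Pr => e e0; have [A HA] := H e e0.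
apply: ge_ereal_inf.
exists (ereal_sup [set (ln (ln (max_modulus f x)) / ln x)%:E
   | x in [set x | A < x]]).
  by exists [set x | A < x] => //; exists A; split => //; exact: num_real.
by apply: ge_ereal_sup => _ [x Ax <-]; rewrite -EFinD lee_fin HA.
Qed.

(** The converse of [derivative_growth], up to the end point. *)
Lemma order_le_of_growth f a (s D : R) : entire f -> 0 < s ->
  (forall n, normc (nderive n f a) <=
      expR (D * n.+1%:R + (1 - s^-1) * (n%:R * ln n%:R))) ->
  (entire_order f <= s%:E)%E.
Proof.
move=> fe s0 HD; apply: order_le => e e0.
pose c1 := expR (s * (D + 2)) / s * expR (s * ln 2).
pose c2 := `|D| + 1 + c1.
have c10 : 0 <= c1 by rewrite mulr_ge0 ?divr_ge0 ?expR_ge0 ?(ltW s0).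
have c21 : 1 <= c2 by rewrite /c2 addrAC lerDr addr_ge0.
exists (Num.max (Num.max 1 (normc a)) (expR (ln c2 / e))) => x.
rewrite !gt_max => /andP[/andP[x1 xa] xe].
have x0 : 0 < x by rewrite (lt_trans ltr01).
have lx0 : 0 < ln x by rewrite ln_gt0.
have c20 : 0 < c2 by rewrite (lt_le_trans ltr01).
have E1 : 1 <= expR (s * ln x) by rewrite -expR0 ler_expR mulr_ge0 ?ltW.
have HM : max_modulus f x <= expR (c2 * expR (s * ln x)).
  apply: max_modulus_le => [|w wx]; first exact: ltW.
  have t1 : 1 <= 2 * x by rewrite mulr_ege1 ?ler1n ?(ltW x1).
  have wa : normc (w - a) <= 2 * x.
    by rewrite (le_trans (le_normcB _ _))// wx mulr_natl mulr2n lerD2l ltW.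
  apply: (le_trans (growth_bound fe s0 HD t1 wa)).
  have -> : expR (s * ln (2 * x)) = expR (s * ln 2) * expR (s * ln x).
    by rewrite lnM ?posrE// mulrDr expRD.
  rewrite ler_expR mulrA -/c1 /c2 [leRHS]mulrDl lerD2r.
  apply: (@le_trans _ _ (`|D| + 1)); first by rewrite lerD2r ler_norm.
  by rewrite ler_peMr// addr_ge0.
rewrite ler_pdivrMr//.
have l0 : ln c2 <= e * ln x.
  rewrite mulrC -ler_pdivrMr// -[leLHS]expRK ler_ln ?posrE ?expR_gt0//.
  exact: ltW.
set m := max_modulus f x in HM *.
have [m1|m1] := leP (ln m) 0.
  by rewrite (ln0 m1) mulr_ge0 ?(ltW lx0)// addr_ge0 ?(ltW s0) ?(ltW e0).
have m0 : 0 < m by rewrite ltNge; apply: contraTN m1 => /ln0 ->; rewrite ltxx.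
have : ln m <= c2 * expR (s * ln x).
  by rewrite -[leRHS]expRK ler_ln ?posrE ?expR_gt0.
rewrite -(ler_ln (x := ln m)) ?posrE ?mulr_gt0 ?expR_gt0// => /le_trans; apply.
by rewrite lnM ?posrE ?expR_gt0// expRK addrC mulrDl lerD2l.
Qed.

Lemma liouville f (B A : R) : entire f ->
  (forall w, A < normc w -> normc (f w) <= B) -> forall w, f w = f 0.
Proof.
move=> fe HB; have D0 z : 'D_(1:C) f z = 0.
  apply/eqP; rewrite -normc_eq0 eq_le normc_ge0 andbT.
  apply/ler_addgt0Pr => e e0; rewrite add0r.
  pose r := `|A| + normc z + 1 + `|B| / e.
  have Be : 0 <= `|B| / e by rewrite divr_ge0// ltW.
  have r0 : 0 < r by rewrite ltr_wpDr// ltr_wpDl// addr_ge0// normc_ge0.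
  apply: (@le_trans _ _ (B / r)).
    apply: (entire_cauchy fe r0) => w wr; apply: HB.
    apply: (@lt_le_trans _ _ (r - normc z)).
      rewrite /r; apply: (le_lt_trans (ler_norm A)).
      have := normc_ge0 z; move: (normc z) => x x0; lra.
    by have := normc_tri w 0 z; rewrite wr subr0 sub0r normcN; lra.
  rewrite ler_pdivrMr// (le_trans (ler_norm B))// mulrC -ler_pdivrMr//.
  rewrite /r lerDr !addr_ge0// normc_ge0//.
move=> w; apply/eqP; rewrite -subr_eq0 -normc_eq0 eq_le normc_ge0 andbT.
have := @mean_value_bound R f ('D_(1:C) f) 0 w 0.
rewrite add0r mul0r; apply => s _; first exact: entire_is_derive.
by rewrite D0 normc0.
Qed.

(** A quotient that stays below -e, with e > 0, forces M(x) <= exp 1 for large x;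
    then f is constant by Liouville's theorem; but for constants the quotient tends to 0. *)
Lemma order_ge0 f : entire f -> (0 <= entire_order f)%E.
Proof.
move=> fe; apply: le_ereal_inf_tmp => _ [V [A [_ HA]] <-].
apply/lee_addgt0Pr => e e0; rewrite leNgt; apply/negP => Hsup.
have Hq x : A < x -> ln (ln (max_modulus f x)) / ln x < - e.
  move=> Ax; rewrite -lte_fin.
  apply: (@le_lt_trans _ _ (ereal_sup [set (ln (ln (max_modulus f x)) / ln x)%:E
    | x in V])); last by rewrite EFinN -[X in (_ < X)%E]add0e lteBrDr.
  by apply: ereal_sup_ubound; exists x => //; exact: HA.
pose A' := Num.max A 1.
have Hl x : A' < x -> ln (ln (max_modulus f x)) < - e * ln x.
  by rewrite gt_max => /andP[/Hq Ax x1]; rewrite -ltr_pdivrMr// ln_gt0.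
have fcst : forall w, f w = f 0.
  apply: (@liouville f (expR 1) A') => // w wA.
  apply: le_trans (max_modulus_ge w (entire_ccontinuous fe)) _.
  have {}wA := wA; have := Hl _ wA.
  move: wA; rewrite gt_max => /andP[_ w1] H.
  rewrite leNgt; apply/negP => Hm.
  have m0 := lt_trans (expR_gt0 1) Hm.
  have : 1 <= ln (max_modulus f (normc w)).
    by rewrite -[leLHS]expRK ler_ln ?posrE ?expR_gt0// ltW.
  move=> /ln_ge0; rewrite leNgt => /negP; apply.
  by apply: lt_trans H _; rewrite mulNr oppr_lt0 mulr_gt0// ln_gt0.
have Mcst x : 0 <= x -> max_modulus f x = normc (f 0).
  move=> x0; apply/eqP; rewrite eq_le; apply/andP; split.
    by apply: max_modulus_le => // w _; rewrite fcst.
  have := max_modulus_ge x%:C (entire_ccontinuous fe).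
  by rewrite normc_real ger0_norm// fcst.
pose k := `|ln (ln (normc (f 0)))|.
(* so large that - e ln x is below the constant value of ln (ln M) *)
pose x := expR (`|A'| + k / e).
have xA : A' < x.
  apply: (le_lt_trans (ler_norm A')); rewrite /x.
  apply: (@lt_le_trans _ _ (1 + (`|A'| + k / e))); last exact: expR_ge1Dx.
  have : 0 <= k / e by rewrite divr_ge0 ?normr_ge0 ?(ltW e0).
  move: (k / e) => y; lra.
have := Hl x xA; rewrite Mcst ?expR_ge0// expRK => H.
have Hk : - k <= ln (ln (normc (f 0))) by rewrite lerNl /k -normrN ler_norm.
have He : 0 <= e * `|A'| by rewrite mulr_ge0// ltW.
have Ek : - e * (`|A'| + k / e) = - (e * `|A'|) - k.
  by field; rewrite gt_eqF.
move: H; rewrite Ek => /(le_lt_trans Hk).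
by rewrite ltrBrDr addNr ltNge oppr_le0 He.
Qed.
End Order.

(** * Time derivatives of a solution of the heat equation *)

Section Heat.
Context {R : realType}.
Local Notation C := (Cplx R).
Implicit Types (f g : C -> C) (t z w a : C) (F G : C -> C -> C).

Lemma entire2_derivable_z F t z : entire2 F -> derivable (F t) z (1:C).
Proof.
move=> Fe; apply/derivable1_diffP.
have H := Fe (t, z).
have K : differentiable (fun w : C => (t, w) : C * C) z.
  by apply: differentiable_pair; [exact: differentiable_cst|].
exact: (@differentiable_comp _ C (C * C)%type C (fun w : C => (t, w))
  (fun q => F q.1 q.2) z K H).
Qed.

Lemma entire2_derivable_t F t z : entire2 F ->
  derivable (fun s => F s z) t (1:C).
Proof.
move=> Fe; apply/derivable1_diffP.
have H := Fe (t, z).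
have K : differentiable (fun w : C => (w, z) : C * C) t.
  by apply: differentiable_pair; [|exact: differentiable_cst].
exact: (@differentiable_comp _ C (C * C)%type C (fun w : C => (w, z))
  (fun q => F q.1 q.2) t K H).
Qed.

Lemma entire2_continuous F t z (e : R) : entire2 F -> 0 < e ->
  exists2 d : R, 0 < d & forall s w, normc (s - t) < d -> normc (w - z) < d ->
    normc (F s w - F t z) <= e.
Proof.
move=> Fe e0; have /differentiable_continuous Fc := Fe (t, z).
have eC : (0 : R[i]) < e%:C by rewrite ltcR.
have /cvgrPdist_le/(_ _ eC)/nbhs_ballP := Fc.
move=> -[_/= /gt0_complexR[d d0 ->] Hd].
exists d => // s w st wz; have := Hd (s, w); rewrite /= normrcE lecR normcB.
apply; split; rewrite /ball /= normrcE ltcR normcB//.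
Qed.

(** Uniformity over discs of w is what allows Cauchy's estimate in w to act on
    increments in time. *)
Definition equicontinuous_t G := forall t r (e : R), 0 < e ->
  exists2 d : R, 0 < d & forall s w, normc (s - t) < d -> normc w <= r ->
    normc (G s w - G t w) <= e.

Lemma entire2_equicontinuous F : entire2 F -> equicontinuous_t F.
Proof.
move=> Fe t r e e0.
have [d d' w d0 dd H s st|z|d d0 Hd] := @disc_uniform R
  (fun d w => forall s, normc (s - t) < d -> normc (F s w - F t w) <= e) _ _ r.
- by apply: H; apply: lt_le_trans dd.
- have [|d d0 Hd] := @entire2_continuous F t z (e / 2) Fe.
    by rewrite divr_gt0.
  exists d => // w wz s st; rewrite (splitr e).
  apply: le_trans (normc_tri _ (F t z) _) _.
  rewrite lerD ?[normc (F t z - _)]normcB ?Hd//.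
  by rewrite subrr normc0.
by exists d => // s w st wr; apply: Hd.
Qed.

Lemma ccontinuousB f g : ccontinuous f -> ccontinuous g ->
  ccontinuous (fun z => f z - g z).
Proof.
move=> fc gc z e e0; have e20 : 0 < e / 2 by rewrite divr_gt0.
have [d d0 Hd] := fc z _ e20; have [d' d'0 Hd'] := gc z _ e20.
exists (Num.min d d'); first by rewrite lt_min d0.
move=> w; rewrite lt_min => /andP[wd wd'].
have -> : f w - g w - (f z - g z) = (f w - f z) - (g w - g z) by ring.
by rewrite (le_trans (le_normcB _ _))// (splitr e) lerD ?Hd ?Hd'.
Qed.

Lemma ccontinuousZ f c : ccontinuous f -> ccontinuous (fun z => c * f z).
Proof.
move=> fc z e e0; have c0 : 0 < normc c + 1 by rewrite ltr_wpDl// normc_ge0.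
have [|d d0 Hd] := fc z (e / (normc c + 1)); first by rewrite divr_gt0.
exists d => // w /Hd; rewrite ler_pdivlMr// => H; rewrite -mulrBr normcM.
by apply: le_trans H; rewrite [leLHS]mulrC ler_wpM2l ?normc_ge0// lerDl.
Qed.

Lemma equicontinuous_derive G : (forall t, entire (G t)) ->
  equicontinuous_t G -> equicontinuous_t (fun t => 'D_(1:C) (G t)).
Proof.
move=> Ge Gc t r e e0; have [d d0 Hd] := Gc t (r + 1) e e0.
exists d => // s w st wr; rewrite -[e]divr1.
have H1 z : is_derive z (1:C) (fun z => G s z - G t z)
    ('D_(1:C) (G s) z - 'D_(1:C) (G t) z).
  by exact: (is_derive_sub (entire_is_derive z (Ge s)) (entire_is_derive z (Ge t))).
apply: (cauchy_estimate H1 (ccontinuousB (Ge s).2 (Ge t).2) ltr01) => x xw.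
apply: Hd => //; have := normc_tri x w 0; rewrite !subr0 xw => /le_trans.
by apply; rewrite addrC lerD2r.
Qed.

(** By Cauchy's estimate in z, the locally uniform convergence of the time
    difference quotients of G passes to their z-derivatives. *)
Lemma time_derive_derive G G' : (forall t, entire (G t)) ->
  (forall t, entire (G' t)) -> equicontinuous_t G' ->
  (forall t z, is_derive t (1:C) (fun s => G s z) (G' t z)) ->
  forall t z, is_derive t (1:C) (fun s => 'D_(1:C) (G s) z)
    ('D_(1:C) (G' t) z).
Proof.
move=> Ge G'e G'c HG t z; apply/is_derive_epsP => e e0.
have [d d0 Hd] := G'c t (normc z + 1) e e0.
exists d => // h hd.
pose g (w : C) : C := G (t + h) w - G t w - h * G' t w.
pose dg (w : C) : C := 'D_(1:C) (G (t + h)) w - 'D_(1:C) (G t) w -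
  h * 'D_(1:C) (G' t) w.
have H1 w : is_derive w (1:C) g (dg w).
  exact: (is_derive_sub (is_derive_sub (entire_is_derive w (Ge _))
    (entire_is_derive w (Ge _))) (is_derive_scale h (entire_is_derive w (G'e t)))).
have H2 : ccontinuous dg.
  exact: (ccontinuousB (ccontinuousB (Ge (t + h)).2 (Ge t).2)
    (ccontinuousZ h (G'e t).2)).
have H3 w : normc (w - z) = 1 -> normc (g w) <= e * normc h.
  move=> wz; rewrite /g [h * _]mulrC.
  apply: (@linear_approx R (fun s => G s w) (fun s => G' s w) t h e (HG^~ w)).
  move=> s /andP[s0 s1]; apply: Hd.
    rewrite addrAC subrr add0r normcM normc_real ger0_norm//.
    by apply: le_lt_trans hd; rewrite ler_piMl ?normc_ge0.
  have := normc_tri w z 0; rewrite !subr0 wz => /le_trans; apply.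
  by rewrite addrC.
have := cauchy_estimate H1 H2 ltr01 H3; rewrite divr1 /dg.
by rewrite [h * _]mulrC.
Qed.

Section Solution.
Variable F : C -> C -> C.
Hypothesis (Fe : entire2 F) (Fh : heat_equation F).

(** The heat equation supplies the second z-derivative, hence the continuity of
    the first one. *)
Lemma heat_entire t : entire (F t) /\ 'D_(1:C) (F t) = partial_z F t.
Proof.
apply: entire_of_is_derive; first by move=> z; apply/derivableP;
  exact: entire2_derivable_z.
exact: (is_derive_ccontinuous (Fh t)).
Qed.

Lemma heat_time_derive k t z :
  is_derive t (1:C) (fun s => nderive k (F s) z) (nderive k.+2 (F t) z).
Proof.
have Fte s : entire (F s) := (heat_entire s).1.
have eq0 : equicontinuous_t F := entire2_equicontinuous Fe.
have eqn n : equicontinuous_t (fun s => nderive n (F s)).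
  elim: n => [|n IH]; first exact: eq0.
  exact: (equicontinuous_derive (fun s => entire_nderive n (Fte s)) IH).
elim: k t z => [|k IH] t z; last first.
  exact: (time_derive_derive (fun s => entire_nderive k (Fte s))
    (fun s => entire_nderive k.+2 (Fte s)) (eqn k.+2) IH t z).
have E1 : nderive 2 (F t) = 'D_(1:C) (partial_z F t).
  by rewrite -(heat_entire t).2.
have E2 : 'D_(1:C) (partial_z F t) z = partial_t F t z :=
  @derive_val _ _ _ _ _ _ _ (Fh t z).
rewrite E1 E2.
by apply/derivableP; exact: entire2_derivable_t.
Qed.

(** All that the heat equation contributes to the comparison of orders: for e at
    most 1, differentiation in t runs through the z-derivatives of one parity. *)
Lemma heat_time_nderive e z :
  entire (fun t => nderive e (F t) z) /\
  forall n t, nderive n (fun t => nderive e (F t) z) t =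
    nderive (n.*2 + e) (F t) z.
Proof.
have E k z' : entire (fun t => nderive k (F t) z') /\
    'D_(1:C) (fun t => nderive k (F t) z') = fun t => nderive k.+2 (F t) z'.
  apply: entire_of_is_derive; first by move=> t; exact: heat_time_derive.
  exact: (is_derive_ccontinuous (fun t => heat_time_derive k.+2 t z')).
split=> [|n]; first exact: (E e z).1.
elim: n => [//|n IH] t.
have {}IH : nderive n (fun t => nderive e (F t) z) =
  fun t => nderive (n.*2 + e) (F t) z by apply/funext.
change ('D_(1:C) (nderive n (fun t => nderive e (F t) z)) t =
  nderive (n.+1.*2 + e) (F t) z).
rewrite IH doubleS !addSn.
exact: (congr1 (@^~ t) (E (n.*2 + e) z).2).
Qed.
End Solution.
End Heat.

(** * Sequences of size exp (b n ln n) *)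

Section GrowthAlgebra.
Context {R : realType}.
Local Notation C := (Cplx R).
Implicit Types (u : nat -> R) (b : R).

Definition xlogx n : R := n%:R * ln n%:R.

(** For u n = |f^(n)(a)| and b = 1 - 1/s this says, in view of Stirling's
    formula, that f has order at most s; D absorbs factors C^n. *)
Definition growth u b := exists D : R, forall n,
  u n <= expR (D * n.+1%:R + b * xlogx n).

Lemma ln_nat_ge0 n : 0 <= ln n%:R :> R.
Proof. by case: n => [|n]; [rewrite ln0|rewrite ln_ge0// ler1n]. Qed.

Lemma ln_nat_le n : ln n%:R <= n%:R :> R.
Proof.
case: n => [|n]; first by rewrite ln0.
by rewrite ltW// ln_sublinear// ltr0n.
Qed.

(** A crude constant for [xlogx_affine]. *)
Definition xlogx_gap c e : R := (c + e)%:R * (c + e)%:R + e%:R.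

(** As n ln n is homogeneous up to O(n), passing to the subsequence c n + e
    multiplies the exponent b by c. *)
Lemma xlogx_affine c e n : (0 < c)%N ->
  0 <= xlogx (c * n + e) - c%:R * xlogx n <= xlogx_gap c e * n.+1%:R.
Proof.
move=> c0; have [->|n0] := posnP n.
  rewrite muln0 add0n /xlogx mul0r mulr0 subr0 mulr1 mulr_ge0 ?ln_nat_ge0//=.
  rewrite /xlogx_gap; apply: (@le_trans _ _ (e%:R * e%:R)).
    by rewrite ler_wpM2l ?ln_nat_le.
  by rewrite ler_wpDr// ler_pM ?ler_nat ?leq_addl.
have n1 : 0 < n%:R :> R by rewrite ltr0n.
have lncn : ln n%:R <= ln (c * n + e)%:R :> R.
  rewrite ler_ln ?posrE ?ltr0n ?ler_nat ?addn_gt0 ?muln_gt0 ?c0 ?n0//.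
  by rewrite (leq_trans (leq_pmull n c0)) ?leq_addr.
apply/andP; split.
  rewrite subr_ge0 /xlogx mulrA -natrM ler_pM ?ln_nat_ge0// ler_nat.
  exact: leq_addr.
rewrite lerBlDl /xlogx mulrA -natrM.
have ce0 : (0 < c + e)%N by rewrite addn_gt0 c0.
have H : ln (c * n + e)%:R <= ln n%:R + (c + e)%:R :> R.
  apply: (@le_trans _ _ (ln n%:R + ln (c + e)%:R)); last first.
    by rewrite lerD2l ln_nat_le.
  rewrite -lnM ?posrE ?ltr0n// ler_ln ?posrE ?mulr_gt0 ?ltr0n//.
    by rewrite -natrM ler_nat; nia.
  by rewrite addn_gt0 muln_gt0 c0 n0.
apply: (@le_trans _ _ ((c * n + e)%:R * (ln n%:R + (c + e)%:R))).
  by rewrite ler_wpM2l.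
rewrite natrD mulrDl mulrDr -addrA lerD2l mulrDr /xlogx_gap.
have Hn : n%:R <= n.+1%:R :> R by rewrite ler_nat.
have H1 : e%:R * ln n%:R <= e%:R * n.+1%:R :> R.
  by rewrite ler_wpM2l// (le_trans (ln_nat_le n)).
have H2 : (c * n)%:R * (c + e)%:R + e%:R * (c + e)%:R <=
    (c + e)%:R * (c + e)%:R * n.+1%:R :> R.
  by rewrite -!natrM -natrD ler_nat; nia.
rewrite addrCA addrC [leRHS]mulrDl; apply: le_trans (lerD H2 H1).
by rewrite -addrA lerD2l addrC.
Qed.

Lemma growth_affine u b c e : (0 < c)%N -> growth u b ->
  growth (fun n => u (c * n + e)%N) (c%:R * b).
Proof.
move=> c0 [D HD]; exists (`|D| * (c + e + 1)%:R + `|b| * xlogx_gap c e) => n.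
apply: le_trans (HD _) _; rewrite ler_expR mulrDl -addrA; apply: lerD.
  apply: (@le_trans _ _ (`|D| * (c * n + e).+1%:R)).
    by rewrite ler_wpM2r// ler_norm.
  rewrite -mulrA -natrM ler_wpM2l ?normr_ge0// ler_nat.
  by nia.
have /andP[g0 g1] := xlogx_affine e n c0.
rewrite -lerBlDr.
have -> : b * xlogx (c * n + e) - c%:R * b * xlogx n =
  b * (xlogx (c * n + e) - c%:R * xlogx n) by ring.
apply: (@le_trans _ _ (`|b| * (xlogx (c * n + e) - c%:R * xlogx n))).
  by rewrite ler_wpM2r// ler_norm.
by rewrite -mulrA ler_wpM2l.
Qed.

Lemma growth_of_parities u b :
  (forall e, (e <= 1)%N -> growth (fun n => u (2 * n + e)%N) (2 * b)) ->
  growth u b.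
Proof.
move=> H; have [D0 H0] := H 0%N isT; have [D1 H1] := H 1%N isT.
pose G : R := Num.max (xlogx_gap 2 0) (xlogx_gap 2 1).
exists (`|D0| + `|D1| + `|b| * G) => k.
have [n [e [e1 ke]]] : exists n e, (e <= 1)%N /\ k = (2 * n + e)%N.
  by exists k./2, (odd k); split; [case: odd|rewrite -{1}(odd_double_half k); lia].
have : u k <= expR ((`|D0| + `|D1|) * n.+1%:R + 2 * b * xlogx n).
  rewrite ke; have [e0|e0] : e = 0%N \/ e = 1%N by lia.
    rewrite e0 (le_trans (H0 n))// ler_expR lerD2r ler_wpM2r//.
    by rewrite (le_trans (ler_norm _))// lerDl.
  rewrite e0 (le_trans (H1 n))// ler_expR lerD2r ler_wpM2r//.
  by rewrite (le_trans (ler_norm _))// lerDr.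
move=> /le_trans; apply.
rewrite ler_expR [(_ + `|b| * G) * _]mulrDl -[leRHS]addrA.
have nk : n.+1%:R <= k.+1%:R :> R by rewrite ler_nat ke; lia.
apply: lerD; first by rewrite ler_wpM2l// addr_ge0.
have /andP[g0 g1] := @xlogx_affine 2 e n isT.
rewrite -ke in g0 g1; rewrite -lerBlDr.
have -> : 2 * b * xlogx n - b * xlogx k = - b * (xlogx k - 2 * xlogx n) by ring.
apply: (@le_trans _ _ (`|b| * (xlogx k - 2 * xlogx n))).
  by rewrite ler_wpM2r// -normrN ler_norm.
rewrite -mulrA ler_wpM2l//; apply: (le_trans g1).
have gG : xlogx_gap 2 e <= G.
  have [->|->] : e = 0%N \/ e = 1%N by lia.
    by rewrite /G le_max lexx.
  by rewrite /G le_max lexx orbT.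
apply: (@le_trans _ _ (G * n.+1%:R)); first by rewrite ler_wpM2r.
by apply: ler_wpM2l nk; rewrite (le_trans _ gG)// addr_ge0// mulr_ge0.
Qed.

Lemma growth_shift u b : growth (fun n => u n.+1) b -> growth u b.
Proof.
move=> [D HD]; pose G : R := xlogx_gap 1 1.
have G0 : 0 <= G by rewrite /G addr_ge0// mulr_ge0.
exists (ln (Num.max 1 (u 0%N)) + `|D| + `|b| * G) => -[|n].
  rewrite /xlogx mul0r mulr0 addr0 mulr1.
  apply: (@le_trans _ _ (Num.max 1 (u 0%N))); first by rewrite le_max lexx orbT.
  rewrite -[leLHS]lnK; last by rewrite posrE lt_max ltr01.
  by rewrite ler_expR -addrA lerDl addr_ge0// mulr_ge0.
apply: le_trans (HD n) _.
rewrite ler_expR [(_ + `|b| * G) * _]mulrDl -[leRHS]addrA; apply: lerD.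
  apply: (@le_trans _ _ (`|D| * n.+1%:R)); first by rewrite ler_wpM2r// ler_norm.
  apply: ler_pM; rewrite ?ler_nat// lerDr ln_ge0// le_max lexx//.
have /andP[g0 g1] := @xlogx_affine 1 1 n isT.
rewrite mul1n addn1 mul1r in g0 g1.
rewrite -lerBlDr.
have -> : b * xlogx n - b * xlogx n.+1 = - b * (xlogx n.+1 - xlogx n) by ring.
apply: (@le_trans _ _ (`|b| * (xlogx n.+1 - xlogx n))).
  by rewrite ler_wpM2r// -normrN ler_norm.
rewrite -mulrA ler_wpM2l//; apply: (le_trans g1).
by rewrite ler_wpM2l// ler_nat.
Qed.

Lemma growth_entire f (a : C) (s : R) : entire f -> 0 < s ->
  (entire_order f < s%:E)%E ->
  growth (fun n => normc (nderive n f a)) (1 - s^-1).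
Proof.
move=> fe s0 fs; have [D HD] := derivative_growth fe s0 fs (normc a).
by exists D => n; exact: HD.
Qed.

(** The limit case s = oo of [growth_entire]: Cauchy's estimate with total
    radius at most 1. *)
Lemma growth_entire1 f (a : C) : entire f ->
  growth (fun n => normc (nderive n f a)) 1.
Proof.
move=> fe; have [M HM] := ccontinuous_bounded (entire_ccontinuous fe)
  (normc a + 1).
exists (ln (Num.max 1 M)) => n.
have K0 : 0 <= ln (Num.max 1 M) by rewrite ln_ge0// le_max lexx.
have := @nderive_cauchy R n f a (expR (- ln n%:R)) (expR (ln (Num.max 1 M)))
  fe (expR_gt0 _).
rewrite -expRM_natl -expRB mulrN opprK => H.
apply: le_trans (H _) _ => [w wa|]; last first.
  by rewrite ler_expR mul1r lerD2r ler_peMr// ler1n.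
rewrite lnK ?posrE ?lt_max ?ltr01//.
apply: (@le_trans _ _ M); last by rewrite le_max lexx orbT.
apply: HM; have := normc_tri w a 0; rewrite !subr0 => /le_trans; apply.
rewrite addrC lerD2l (le_trans wa)//; case: n {H wa} => [|n].
  by rewrite mul0r.
by rewrite expRN lnK ?posrE ?ltr0n// divff// pnatr_eq0.
Qed.

Lemma order_le_growth f (a : C) (s : R) : entire f -> 0 < s ->
  growth (fun n => normc (nderive n f a)) (1 - s^-1) ->
  (entire_order f <= s%:E)%E.
Proof. by move=> fe s0 [D HD]; exact: (order_le_of_growth fe s0 HD). Qed.
End GrowthAlgebra.

(** * Orders in space and in time *)

Section HeatOrders.
Context {R : realType}.
Local Notation C := (Cplx R).
Variable F : C -> C -> C.
Hypothesis (Fe : entire2 F) (Fh : heat_equation F).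

(** [torder F 0] and [torder F 1] are convertible to [t_order0 F] and
    [t_order1 F]; the parity e lets both be treated at once. *)
Definition torder e z : \bar R := entire_order (fun t => nderive e (F t) z).

Let Fte t : entire (F t) := (heat_entire Fe Fh t).1.

(** The exponents match because 2 (1 - 1/s) = 1 - 1/tau for tau = s / (2 - s). *)
Lemma torder_le t e z (s : R) : (e <= 1)%N -> 0 < s < 2 ->
  (z_order F t < s%:E)%E -> (torder e z <= (s / (2 - s))%:E)%E.
Proof.
move=> e1 /andP[s0 s2] Fs; have [te tD] := heat_time_nderive Fe Fh e z.
apply: (@order_le_growth R _ t _ te); first by rewrite divr_gt0// subr_gt0.
have [D HD] := growth_affine e (isT : (0 < 2)%N) (growth_entire z (Fte t) s0 Fs).
exists D => n; rewrite tD -mul2n.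
have -> : 1 - (s / (2 - s))^-1 = 2%:R * (1 - s^-1).
  by field; rewrite !gt_eqF// subr_gt0.
exact: HD.
Qed.

Lemma growth_torder t e z (s : R) : 0 < s -> (torder e z < s%:E)%E ->
  growth (fun n => normc (nderive (2 * n + e) (F t) z)) (1 - s^-1).
Proof.
move=> s0 Hs; have [te tD] := heat_time_nderive Fe Fh e z.
have [D HD] := growth_entire t te s0 Hs.
by exists D => n; have := HD n; rewrite tD -mul2n.
Qed.

(** The computation of [torder_le] read backwards; both parities are required to
    recover all z-derivatives. *)
Lemma z_order_le t z (s : R) : 0 < s ->
  (torder 0 z < s%:E)%E -> (torder 1 z < s%:E)%E ->
  (z_order F t <= (2 * s / (1 + s))%:E)%E.
Proof.
move=> s0 H0 H1; apply: (@order_le_growth R _ z _ (Fte t)).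
  by rewrite divr_gt0 ?mulr_gt0 ?addr_gt0.
apply: growth_of_parities => e e1.
have -> : 2 * (1 - (2 * s / (1 + s))^-1) = 1 - s^-1.
  by field; rewrite !gt_eqF ?addr_gt0.
have [->|->] : e = 0%N \/ e = 1%N by lia.
  exact: (growth_torder t s0 H0).
exact: (growth_torder t s0 H1).
Qed.

(** As F is entire in t, its t-derivatives have exponent 1, so the z-derivatives
    have exponent 1/2 = 1 - 1/2. *)
Lemma z_order_le2 t : (z_order F t <= 2%:E)%E.
Proof.
apply: (@order_le_growth R _ 0 _ (Fte t)) => //.
apply: growth_of_parities => e e1.
have -> : 2 * (1 - 2^-1) = 1 :> R by field.
have [te tD] := heat_time_nderive Fe Fh e 0.
have [D HD] := growth_entire1 t te.
by exists D => n; have := HD n; rewrite tD -mul2n.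
Qed.
End HeatOrders.

(** * Lagrange interpolation at spaced points *)

Section Interpolation.
Context {R : realType}.
Local Notation C := (Cplx R).

(** Greedy choice from the left: taking a point of A within h of inf A, and
    discarding all of A up to distance h beyond it, costs measure at most 2 h. *)
Lemma spaced_points (h : R) : 0 < h -> forall (m : nat) (A : set R),
  measurable A -> has_lbound A ->
  ((m%:R * (2 * h))%:E < lebesgue_measure A)%E ->
  exists p : nat -> R, (forall i, (i < m)%N -> A (p i)) /\
    forall i j, (i <= j < m)%N -> p i + (j - i)%:R * h <= p j.
Proof.
move=> h0; elim=> [|m IH] A mA [l Al] HA.
  by exists (fun=> 0); split=> // i j /andP[].
have A0 : A !=set0.
  apply/set0P; apply/eqP => A0; move: HA; rewrite A0 measure0 lte_fin.
  by rewrite ltNge mulr_ge0// mulr_ge0// ltW.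
have lA : has_inf A by split => //; exists l.
have [x Ax xh] := inf_adherent h0 lA.
pose I : set R := `[inf A, x + h[%classic.
pose A' := A `&` ~` I.
have mI : measurable I by exact: measurable_itv.
have mA' : measurable A' by apply: measurableI => //; exact: measurableC.
have infx : inf A <= x by apply: ge_inf => //; exists l.
have A'x y : A' y -> x + h <= y.
  move=> [Ay]; rewrite /I /= in_itv /= => /negP; rewrite negb_and -ltNge -leNgt.
  by rewrite ltNge ge_inf//=; exists l.
have [||p [pA pgap]] := IH A' mA'.
- by exists l => y [Ay _]; apply: Al.
- have AI : (lebesgue_measure (A `&` I) <= (2 * h)%:E)%E.
    apply: (@le_trans _ _ (lebesgue_measure I)).
      apply: le_measure; rewrite ?inE; [exact: measurableI|exact: mI|].
      by move=> y [].
    have ixh : inf A < x + h by move: h0 infx; lra.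
    rewrite lebesgue_measure_itv /= lte_fin ixh.
    by rewrite -EFinB lee_fin; lra.
  rewrite ltNge; apply/negP => HA'.
  move: HA; rewrite (@measureDI _ _ _ lebesgue_measure A I mA mI) ltNge.
  move=> /negP; apply.
  have -> : ((m.+1%:R * (2 * h))%:E = (m%:R * (2 * h))%:E + (2 * h)%:E)%E.
    by rewrite -EFinD -natr1 mulrDl mul1r.
  by apply: leeD => //; rewrite setDE.
exists (fun i => if i is k.+1 then p k else x).
split=> [[|i] im|[|i] [|j] /andP[ij jm]].
- exact: Ax.
- by have [] := pA i im.
- by rewrite mul0r addr0.
- have := pgap 0%N j; rewrite leq0n /= => /(_ jm).
  rewrite !subn0 => H; apply: le_trans H.
  have /A'x p0 := pA 0%N (leq_ltn_trans (leq0n j) jm).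
  by rewrite -natr1 mulrDl mul1r addrA addrAC lerD2r.
- by [].
- by rewrite subSS; apply: pgap; rewrite -ltnS ij.
Qed.

Lemma prod_dist_fact m (j : 'I_m.+1) :
  \prod_(i < m.+1 | i != j) (`|i - j|)%N = (j`! * (m - j)`!)%N.
Proof.
have jm : (j <= m)%N by rewrite -ltnS ltn_ord.
transitivity (\prod_(0 <= i < m.+1 | i != j :> nat) `|i - j|)%N.
  by rewrite big_mkord.
move: (nat_of_ord j) jm => {}j jm.
rewrite (big_cat_nat (n := j)) //=; last exact: leqW.
congr (_ * _)%N.
  rewrite big_nat_cond (eq_bigl (fun i => (0 <= i < j)%N)); last first.
    by move=> i /=; case: ltngtP; rewrite ?andbF.
  rewrite -big_nat; move: j {jm} => k.
  rewrite big_mkord; elim: k => [|k IH]; first by rewrite big_ord0.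
  rewrite big_ord_recl factS -IH; congr (_ * _)%N.
    by rewrite distnEr.
  by apply: eq_bigr => i _; rewrite lift0; lia.
rewrite big_ltn_cond ?ltnS// eqxx /=.
have -> : (m.+1 = (m - j) + j.+1)%N by rewrite addnS subnK.
rewrite -{1}[j.+1]add0n big_addn addnK.
rewrite (eq_bigl xpredT); last by move=> i; rewrite gtn_eqF// addnS ltnS leq_addl.
elim: (m - j)%N => [|k IH]; first by rewrite big_geq.
rewrite big_nat_recr //= IH factS mulnC; congr (_ * _)%N.
lia.
Qed.

Lemma bin_le_exp2 n k : ('C(n, k) <= 2 ^ n)%N.
Proof.
have [kn|nk] := leqP k n; last by rewrite bin_small.
rewrite -[2%N]/(1 + 1)%N expnDn.
rewrite (bigD1 (Ordinal (kn : (k < n.+1)%N)))//= !exp1n !muln1.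
exact: leq_addr.
Qed.

(** The distances from p j to the other nodes multiply to at least
    h^m j! (m - j)!, and m! / (j! (m - j)!) is at most 2^m. *)
Lemma lagrange_bound m (P : {poly R[i]}) (p : nat -> R[i]) (z : R[i])
    (h rho d : R) : (size P <= m.+1)%N -> 0 < h -> 0 <= rho -> 0 <= d ->
  (forall i j, (i <= j <= m)%N -> (j - i)%:R * h <= normc (p j - p i)) ->
  (forall i, (i <= m)%N -> normc (z - p i) <= rho) ->
  (forall i, (i <= m)%N -> normc P.[p i] <= d) ->
  normc P.[z] <= m.+1%:R * d * ((2 * rho / h) ^+ m / m`!%:R).
Proof.
move=> sP h0 rho0 d0 Hgap Hz HP.
have pgap (i j : 'I_m.+1) : `|i - j|%N%:R * h <= normc (p j - p i).
  have [ij|ij] := leqP i j; first by rewrite distnEr// Hgap// ij -ltnS ltn_ord.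
  by rewrite normcB distnEl ?(ltnW ij)// Hgap// (ltnW ij) -ltnS ltn_ord.
have pneq (i j : 'I_m.+1) : i != j -> p j - p i != 0.
  move=> ij; rewrite -normc_gt0; apply: lt_le_trans (pgap i j).
  by rewrite mulr_gt0// ltr0n lt0n distn_eq0.
pose L (j : 'I_m.+1) := \prod_(i < m.+1 | i != j)
  ((p j - p i)^-1 *: ('X - (p i)%:P)).
have LE j x : (L j).[x] = \prod_(i < m.+1 | i != j) ((x - p i) / (p j - p i)).
  rewrite horner_prod; apply: eq_bigr => i _.
  by rewrite hornerZ !hornerE mulrC.
have PE : P = \sum_(j < m.+1) P.[p j] *: L j.
  apply/eqP; rewrite -subr_eq0; apply/eqP.
  apply: (@roots_geq_poly_eq0 _ _ [seq p (nat_of_ord i) | i <- enum 'I_m.+1]).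
  - apply/allP => _ /mapP[k _ ->]; rewrite rootE !hornerE horner_sum.
    rewrite (bigD1 k)//= big1 => [|j jk]; last first.
      rewrite hornerZ LE (bigD1 k) 1?eq_sym//= subrr !mul0r mulr0 //.
    rewrite hornerZ LE big1 ?mulr1 ?addr0 ?subrr// => i ik.
    by rewrite divff// pneq.
  - rewrite map_inj_uniq ?enum_uniq// => i j pij; apply/eqP; apply: contraT.
    by move=> /pneq; rewrite pij subrr eqxx.
  - rewrite size_map size_enum_ord.
    apply: (leq_trans (size_polyD _ _)); rewrite geq_max sP size_polyN /=.
    apply: (leq_trans (size_sum _ _ _)); apply/bigmax_leqP => j _.
    apply: (leq_trans (size_scale_leq _ _)).
    apply: (leq_trans (size_poly_prod_leq _ _)).
    rewrite leq_subLR; apply: (@leq_trans (\sum_(i < m.+1 | i != j) 2).+1).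
      rewrite ltnS; apply: leq_sum => i _.
      by rewrite (leq_trans (size_scale_leq _ _))// size_XsubC.
    rewrite sum_nat_const.
    have -> : #|(fun i : 'I_m.+1 => i != j)| = m.
      by have := cardC1 j; rewrite card_ord.
    lia.
rewrite PE horner_sum; apply: le_trans (le_normc_sum _) _.
have -> : m.+1%:R * d * ((2 * rho / h) ^+ m / m`!%:R) =
  \sum_(j < m.+1) d * ((2 * rho / h) ^+ m / m`!%:R).
  by rewrite sumr_const card_ord -[RHS]mulr_natl [RHS]mulrA.
apply: ler_sum => j _; rewrite hornerZ normcM.
have jm : (j <= m)%N by rewrite -ltnS ltn_ord.
apply: ler_pM; rewrite ?normc_ge0 ?HP// LE.
have normc_prod (Q : pred 'I_m.+1) (G : 'I_m.+1 -> R[i]) :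
    normc (\prod_(i | Q i) G i) = \prod_(i | Q i) normc (G i).
  by apply: (big_morph _ (@normcM R)); exact: normc1.
rewrite normc_prod.
apply: (@le_trans _ _ (\prod_(i < m.+1 | i != j) (rho / h / `|i - j|%N%:R))).
  apply: ler_prod => i ij; rewrite normc_ge0 normcM normcV -mulrA /=.
  have ij0 : 0 < `|i - j|%N%:R :> R by rewrite ltr0n lt0n distn_eq0.
  apply: ler_pM; rewrite ?normc_ge0 ?invr_ge0 ?normc_ge0//.
    by rewrite Hz// -ltnS ltn_ord.
  rewrite -invfM lef_pV2 ?posrE ?mulr_gt0// ?normc_gt0 ?pneq//.
  by rewrite mulrC pgap.
rewrite prodf_div prodr_const.
have -> : #|(fun i : 'I_m.+1 => i != j)| = m.
  by have := cardC1 j; rewrite card_ord.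
rewrite -natr_prod prod_dist_fact.
have -> : (2 * rho / h) ^+ m = (rho / h) ^+ m * 2 ^+ m.
  by rewrite -exprMn; congr (_ ^+ _); ring.
rewrite -mulrA ler_wpM2l ?exprn_ge0 ?divr_ge0 ?(ltW h0)//.
rewrite ler_pdivlMr ?ltr0n ?fact_gt0// mulrC ler_pdivrMr.
  rewrite -natrX -natrM ler_nat -(bin_fact jm) leq_mul2r.
  by rewrite bin_le_exp2 orbT.
by rewrite ltr0n muln_gt0 !fact_gt0.
Qed.
End Interpolation.

(** * A Remez inequality *)

Section Remez.
Context {R : realType}.
Local Notation C := (Cplx R).

(** Lagrange interpolation at m + 1 points of B whose spacing h is proportional
    to 1/m; the resulting factor (C m)^m / m! is only exponential in m. *)
Lemma remez (B : set R) (r : R) (x : R[i]) : measurable B ->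
  (forall y, B y -> `|y| <= r) -> (0 < lebesgue_measure B)%E ->
  exists2 K : R, 0 <= K & forall m (P : {poly R[i]}) (d : R) z,
    (size P <= m.+1)%N -> 0 <= d ->
    (forall y, B y -> normc P.[x + y *i] <= d) ->
    normc (z - x) <= 1 -> normc P.[z] <= d * expR (K * m.+1%:R).
Proof.
move=> mB Br B0.
have [mu mu0 muB] : exists2 mu : R, 0 < mu & (mu%:E < lebesgue_measure B)%E.
  move: B0; case: (lebesgue_measure B) => [b|_|//].
    rewrite lte_fin => b0; exists (b / 2); first by rewrite divr_gt0.
    by rewrite lte_fin ltr_pdivrMr// ltr_pMr// ltr1n.
  by exists 1; rewrite // ltry.
pose r' : R := `|r|; pose rho : R := 1 + r'.
have rho0 : 0 < rho by have := normr_ge0 r; rewrite /rho /r'; lra.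
pose q := Num.max 1 (4 * rho / mu).
have lq0 : 0 <= ln q by rewrite ln_ge0// le_max lexx.
exists (2 + ln q) => [|m P d z sP d0 HP zx]; first by rewrite addr_ge0.
have m0 : 0 < m.+1%:R :> R by rewrite ltr0n.
pose h := mu / (2 * m.+1%:R); have h0 : 0 < h by rewrite divr_gt0// mulr_gt0.
have [||p [pB pgap]] := @spaced_points R h h0 m.+1 B mB.
- by exists (- r) => y /Br; rewrite ler_norml => /andP[].
- have -> : m.+1%:R * (2 * h) = mu.
    by rewrite /h; move: m.+1%:R m0 => k k0; field; rewrite gt_eqF.
  exact: muB.
pose t (i : nat) : R[i] := x + (p i) *i.
have tB i j : t j - t i = (p j - p i) *i.
  by rewrite /t opprD addrACA subrr add0r; congr Complex; rewrite subr0.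
have normci y : normc (y *i : R[i]) = `|y|.
  by rewrite /normc /= expr0n add0r sqrtr_sqr.
have := @lagrange_bound R m P t z h rho d sP h0 (ltW rho0) d0.
move=> H; apply: le_trans (H _ _ _) _.
- move=> i j ijm; rewrite tB normci.
  apply: le_trans (ler_norm _); rewrite lerBrDl; apply: pgap.
  by rewrite ltnS.
- move=> i im; rewrite /t opprD addrA (le_trans (le_normcB _ _))//.
  rewrite normci lerD// (le_trans (Br _ (pB _ _)))// ler_norm//.
- by move=> i im; apply: HP; apply: pB.
have -> : (2 * rho / h) ^+ m / m`!%:R =
    (4 * rho / mu) ^+ m * (m.+1%:R ^+ m / m`!%:R).
  rewrite mulrA -exprMn; congr (_ ^+ _ / _); rewrite /h; field.
  by rewrite !gt_eqF.
rewrite [m.+1%:R * d]mulrC -[leLHS]mulrA; apply: ler_wpM2l => //.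
have Hm : m.+1%:R <= expR m.+1%:R :> R.
  by apply: le_trans (expR_ge1Dx _); rewrite lerDr.
have Hf : m.+1%:R ^+ m / m`!%:R <= expR m.+1%:R :> R.
  rewrite ler_pdivrMr ?ltr0n ?fact_gt0// -(ler_pM2l m0) -exprS.
  rewrite mulrCA -natrM -factS; exact: natr_expn_le.
have Hq : (4 * rho / mu) ^+ m <= expR (ln q * m.+1%:R).
  rewrite expRM_natr lnK; last by rewrite posrE lt_max ltr01.
  apply: (@le_trans _ _ (q ^+ m)).
    rewrite lerXn2r ?nnegrE ?divr_ge0 ?mulr_ge0 ?(ltW rho0) ?(ltW mu0)//.
      by rewrite le_max ler01.
    by rewrite le_max lexx orbT.
  by rewrite ler_weXn2l// le_max lexx.
have -> : (2 + ln q) * m.+1%:R = m.+1%:R + (ln q * m.+1%:R + m.+1%:R) by ring.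
rewrite !expRD ler_pM// ?mulr_ge0 ?exprn_ge0 ?divr_ge0 ?mulr_ge0 ?(ltW rho0)
  ?(ltW mu0) ?exprn_ge0//.
by rewrite ler_pM ?exprn_ge0 ?divr_ge0 ?mulr_ge0 ?(ltW rho0) ?(ltW mu0)
  ?exprn_ge0.
Qed.

End Remez.

(** * Null sets in the plane *)

Section NullSets.
Context {R : realType}.
Local Notation C := (Cplx R).
Local Notation leb := (@lebesgue_measure R).

(** There are countably many boxes with rational corners. *)
Lemma measurable_box_open (U : set (R * R)) :
  (forall p, U p -> exists2 d : R, 0 < d & forall q : R * R,
     `|q.1 - p.1| < d -> `|q.2 - p.2| < d -> U q) -> measurable U.
Proof.
move=> HU.
pose box (i : rat * rat * rat * rat) : set (R * R) :=
  `]ratr i.1.1.1, ratr i.1.1.2[%classic `*` `]ratr i.1.2, ratr i.2[%classic.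
pose D (i : rat * rat * rat * rat) := if `[< box i `<=` U >] then box i else set0.
have -> : U = \bigcup_i D i.
  apply/seteqP; split=> [[x y] /HU[d d0 Hd]|p [i _]]; last first.
    by rewrite /D; case: asboolP => // H /H.
  have xd (u : R) : exists a b : rat, [/\ u - d < ratr a, ratr a < u,
      u < ratr b & ratr b < u + d].
    have [|a] := @rat_in_itvoo R (u - d) u; first by rewrite ltrBlDr ltrDl.
    have [|b] := @rat_in_itvoo R u (u + d); first by rewrite ltrDl.
    rewrite !in_itv /= => /andP[b1 b2] /andP[a1 a2].
    by exists a, b.
  have [a [b [a1 a2 b1 b2]]] := xd x; have [a' [b' [a'1 a'2 b'1 b'2]]] := xd y.
  exists (a, b, a', b') => //; rewrite /D asboolT.
    by split; rewrite /= in_itv /= ?a2 ?b1 ?a'2 ?b'1.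
  move=> [x' y'] [/=]; rewrite !in_itv /= => /andP[u1 u2] /andP[v1 v2].
  by apply: Hd => /=; rewrite ltr_norml; apply/andP; split; lra.
apply: countable_bigcupT_measurable => [|i]; first exact: countableP.
rewrite /D; case: asboolP => _; last exact: measurable0.
by apply: measurableX; exact: measurable_itv.
Qed.

(** Tonelli's theorem, built into the definition of the product measure. *)
Lemma negligible_sections (A : set (R * R)) : measurable A ->
  (forall x, leb (xsection A x) = 0%E) -> (leb \x leb)%E.-negligible A.
Proof.
move=> mA HA; exists A; split => //.
rewrite /product_measure1 /=; apply: integral0_eq => x _ /=.
exact: HA.
Qed.

Definition centered_itv (k : nat) : set R := `[- k%:R, k%:R]%classic.

Lemma positive_bounded_part (B : set R) : measurable B ->
  (0 < leb B)%E -> exists k : nat, (0 < leb (B `&` centered_itv k))%E.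
Proof.
move=> mB B0; apply: contrapT => H.
have H0 k : leb (B `&` centered_itv k) = 0%E.
  apply/eqP; rewrite eq_le measure_ge0 andbT leNgt; apply/negP => Hk.
  by apply: H; exists k.
have : leb.-negligible (\bigcup_k (B `&` centered_itv k)).
  apply: negligible_bigcup => k; apply/negligibleP; last exact: H0.
  by apply: measurableI => //; exact: measurable_itv.
have -> : \bigcup_k (B `&` centered_itv k) = B.
  apply/seteqP; split=> [y [k _ []]//|y By].
  exists (Num.truncn `|y|).+1 => //; split=> //=.
  by rewrite /centered_itv /= in_itv /= -ler_norml ltW// truncnS_gt.
by move=> /negligibleP -/(_ mB) E; rewrite E ltxx in B0.
Qed.
End NullSets.

(** * Growth on a set of positive length *)

Section Propagation.
Context {R : realType}.
Local Notation C := (Cplx R).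
Implicit Types (f g : C -> C).

Definition taylor_poly m f (a : C) : {poly R[i]} :=
  \sum_(k < m) (nderive k f a / k`!%:R) *: ('X - a%:P) ^+ k.

Lemma horner_taylor_poly m f (a z : C) : (taylor_poly m f a).[z] = taylor m f a z.
Proof.
rewrite /taylor_poly horner_sum; apply: eq_bigr => k _.
by rewrite hornerZ horner_exp hornerXsubC mulrAC mulrA.
Qed.

Lemma size_taylor_poly m f (a : C) : (size (taylor_poly m f a) <= m)%N.
Proof.
apply: (leq_trans (size_sum _ _ _)); apply/bigmax_leqP => k _.
by apply: (leq_trans (size_scale_leq _ _)); rewrite size_exp_XsubC ltn_ord.
Qed.

Let leq_affine L e n : (((L + 2) * n + (e + 1)).+1 <= (L + e + 4) * n.+1)%N.
Proof. by nia. Qed.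

Let leq_affine1 L n : ((L * n).+1 <= (L + 1) * n.+1)%N.
Proof. by nia. Qed.

(** Compare f^(2n+e) with its Taylor polynomial of degree L n at x.  Order less
    than 3 gives the derivatives of f the exponent 2/3, and the remainder the
    exponent (L + 2) 2/3 - L = (4 - L) / 3, at most b once L >= 4 - 3 b.  The
    degree being linear in n, the Remez inequality moves the bound from B to the
    whole disc at the cost of a factor exp (O(n)).  No loss in b occurs, which is
    what distinguishes this from a two-constants estimate. *)
Lemma growth_near_line f e (b : R) (x : C) (B : set R) : entire f ->
  (entire_order f < 3%:E)%E -> measurable B -> (0 < lebesgue_measure B)%E ->
  (exists D : R, forall y, B y -> forall n,
    normc (nderive (2 * n + e) f (x + y *i)) <=
      expR (D * n.+1%:R + b * xlogx n)) ->
  exists D : R, forall z, normc (z - x) <= 1 -> forall n,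
    normc (nderive (2 * n + e) f z) <= expR (D * n.+1%:R + b * xlogx n).
Proof.
move=> fe f3 mB0 B00 [D HD0].
have [k B0] := positive_bounded_part mB0 B00.
pose B1 := B `&` centered_itv k.
have mB : measurable B1 by apply: measurableI => //; exact: measurable_itv.
have Bk (y : R) : B1 y -> `|y| <= k%:R.
  by move=> [_]; rewrite /centered_itv /= in_itv /= ler_norml.
have HD y : B1 y -> forall n, normc (nderive (2 * n + e) f (x + y *i)) <=
    expR (D * n.+1%:R + b * xlogx n) by move=> [By _]; exact: HD0.
have [K K0 HK] := remez x mB Bk B0.
pose rho : R := 1 + k%:R.
have rho1 : 1 <= rho by rewrite lerDl.
have rho0 : 0 < rho := lt_le_trans ltr01 rho1.
have [D1 HD1] := derivative_growth fe (ltr0Sn R 2) f3 (normc x + rho).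
pose L := (Num.truncn `|4 - 3 * b|).+1.
have HL : 4 - 3 * b <= L%:R by rewrite (le_trans (ler_norm _))// ltW// truncnS_gt.
pose D2 : R := `|D1| * (L + e + 4)%:R + 2 / 3 * xlogx_gap (L + 2) (e + 1) +
   (L + 1)%:R * (ln rho + 1).
have Hrem n z : normc (z - x) <= rho ->
    normc (nderive (2 * n + e) f z -
      taylor (L * n).+1 (nderive (2 * n + e) f) x z) <=
    expR (D2 * n.+1%:R + b * xlogx n).
  move=> zx; pose m := (L * n).+1; pose k' := ((L + 2) * n + (e + 1))%N.
  pose S := expR (D1 * k'.+1%:R + (1 - 3^-1) * xlogx k').
  have HS w : normc (w - x) <= normc (z - x) ->
      normc (nderive m (nderive (2 * n + e) f) w) <= S.
    move=> wx; have -> : nderive m (nderive (2 * n + e) f) = nderive k' f.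
      have E : (m + (2 * n + e) = k')%N by rewrite /m /k' !mulnDl; ring.
      by rewrite /nderive -iterD E.
    apply: HD1; have := normc_tri w x 0; rewrite !subr0 => /le_trans; apply.
    by rewrite addrC lerD2l (le_trans wx).
  apply: le_trans (taylor_remainder (entire_nderive _ fe) HS) _.
  apply: (@le_trans _ _ (S * (expR (m%:R * ln rho) /
      expR (m%:R * ln m%:R - m%:R)))).
    rewrite -mulrA; apply: ler_wpM2l; first exact: expR_ge0.
    apply: ler_pM; rewrite ?invr_ge0 ?exprn_ge0 ?normc_ge0//.
      rewrite expRM_natl lnK ?posrE//.
      by rewrite lerXn2r ?nnegrE ?normc_ge0 ?(ltW rho0).
    by rewrite lef_pV2 ?posrE ?expR_gt0 ?fact_lower// ltr0n fact_gt0.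
  rewrite -expRB -expRD ler_expR.
  have X0 : 0 <= xlogx n :> R by rewrite mulr_ge0 ?ln_nat_ge0.
  have /andP[_ g1] := @xlogx_affine R (L + 2) (e + 1) n isT.
  have /andP[g2 _] := @xlogx_affine R L 1 n isT.
  rewrite -/k' in g1.
  have mE : (L * n + 1)%N = m by rewrite addn1.
  rewrite mE in g2.
  have E1 : D1 * k'.+1%:R <= `|D1| * (L + e + 4)%:R * n.+1%:R.
    apply: (@le_trans _ _ (`|D1| * k'.+1%:R)).
      by rewrite ler_wpM2r// ler_norm.
    by rewrite -mulrA -natrM ler_wpM2l ?normr_ge0// ler_nat /k' leq_affine.
  have E2 : m%:R * (ln rho + 1) <= (L + 1)%:R * (ln rho + 1) * n.+1%:R.
    rewrite mulrAC -natrM; apply: ler_wpM2r; first by rewrite addr_ge0 ?ln_ge0.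
    by rewrite ler_nat /m leq_affine1.
  have E3 : (2 / 3 * (L + 2)%:R - L%:R) * xlogx n <= b * xlogx n.
    by apply: ler_wpM2r => //; rewrite natrD; move: HL; lra.
  rewrite -/(xlogx m) /D2.
  move: E1 E2 E3 g1 g2.
  move: (xlogx m) (xlogx k') (xlogx n : R) (xlogx_gap _ _) => Xm Xk Xn G.
  rewrite (natrD _ L 2).
  move: (n.+1%:R : R) (k'.+1%:R : R) (m%:R : R) (L%:R : R) (ln rho).
  move: ((L + e + 4)%:R : R) ((L + 1)%:R : R) => c1 c2 N kk M l lr.
  move=> E1 E2 E3 g1 g2; rewrite -subr_ge0.
  have -> : (`|D1| * c1 + 2 / 3 * G + c2 * (lr + 1)) * N + b * Xn -
      (D1 * kk + (1 - 3^-1) * Xk + (M * lr - (Xm - M))) =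
    (`|D1| * c1 * N - D1 * kk) + (c2 * (lr + 1) * N - M * (lr + 1)) +
    (b * Xn - (2 / 3 * (l + 2) - l) * Xn) +
    (2 / 3 * (G * N - (Xk - (l + 2) * Xn)) + (Xm - l * Xn)) by field.
  apply: addr_ge0.
    by apply: addr_ge0; [apply: addr_ge0|]; rewrite subr_ge0.
  apply: addr_ge0; last exact: g2.
  by apply: mulr_ge0; [lra|rewrite subr_ge0].
pose D3 := `|D| + `|D2|.
exists (D3 + K * (L + 1)%:R + 2) => z zx n.
set g := nderive (2 * n + e) f.
pose Y := expR (D3 * n.+1%:R + b * xlogx n).
have YE : expR (D2 * n.+1%:R + b * xlogx n) <= Y.
  rewrite ler_expR lerD2r ler_wpM2r// (le_trans (ler_norm _))// lerDr//.
have YD : expR (D * n.+1%:R + b * xlogx n) <= Y.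
  rewrite ler_expR lerD2r ler_wpM2r// (le_trans (ler_norm _))// lerDl//.
have rem w : normc (w - x) <= rho ->
    normc (g w - (taylor_poly (L * n).+1 g x).[w]) <= Y.
  by move=> wx; rewrite horner_taylor_poly (le_trans (Hrem n w wx)).
have HP := HK _ _ (Y + Y) z (size_taylor_poly (L * n).+1 g x) _ _ zx.
have {}HP : normc (taylor_poly (L * n).+1 g x).[z] <=
    (Y + Y) * expR (K * (L * n).+1%:R).
  apply: HP; first by rewrite addr_ge0 ?expR_ge0.
  move=> y By; have := normc_tri (taylor_poly (L * n).+1 g x).[x + y *i]
    (g (x + y *i)) 0.
  rewrite !subr0 => /le_trans; apply; apply: lerD; last first.
    exact: (le_trans (HD y By n)).
  rewrite normcB; apply: rem; rewrite addrAC subrr add0r.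
  rewrite /normc /= expr0n add0r sqrtr_sqr (le_trans (Bk _ By))//.
  by rewrite lerDr.
have := normc_tri (g z) (taylor_poly (L * n).+1 g x).[z] 0.
rewrite !subr0 => /le_trans; apply.
have zr : normc (z - x) <= rho by rewrite (le_trans zx).
apply: le_trans (lerD (rem z zr) HP) _.
have KL : expR (K * (L * n).+1%:R) <= expR (K * (L + 1)%:R * n.+1%:R).
  by rewrite ler_expR -mulrA -natrM ler_wpM2l// ler_nat leq_affine1.
have KL1 : 1 <= expR (K * (L + 1)%:R * n.+1%:R).
  by rewrite -expR0 ler_expR !mulr_ge0.
have -> : expR ((D3 + K * (L + 1)%:R + 2) * n.+1%:R + b * xlogx n) =
  Y * expR (K * (L + 1)%:R * n.+1%:R) * expR (2 * n.+1%:R).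
  by rewrite -!expRD; congr expR; ring.
have e3 : 3 <= expR (2 * n.+1%:R) :> R.
  apply: le_trans (expR_ge1Dx _); have : 1 <= n.+1%:R :> R by rewrite ler1n.
  by lra.
move: KL KL1 e3; have Y0 : 0 < Y by exact: expR_gt0.
move: (expR (K * (L * n).+1%:R)) (expR (K * _ * _)) (expR (2 * _)) => u v w.
move=> uv v1 w3.
apply: (@le_trans _ _ (Y * v * 3)); last first.
  by rewrite ler_wpM2l// mulr_ge0 ?(ltW Y0)// (le_trans _ v1).
have -> : Y + (Y + Y) * u = Y * (1 + 2 * u) by ring.
by rewrite -mulrA ler_wpM2l ?(ltW Y0)//; move: uv v1; lra.
Qed.

(** Having a bound on a whole disc, Cauchy's estimate yields the derivatives of
    the other parity. *)
Lemma growth_of_line f e (b : R) (x : C) (B : set R) : (e <= 1)%N ->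
  entire f ->
  (entire_order f < 3%:E)%E -> measurable B -> (0 < lebesgue_measure B)%E ->
  (exists D : R, forall y, B y -> forall n,
    normc (nderive (2 * n + e) f (x + y *i)) <=
      expR (D * n.+1%:R + b * xlogx n)) ->
  growth (fun n => normc (nderive n f x)) (b / 2).
Proof.
move=> e1 fe f3 mB B0 HB.
have [D HD] := growth_near_line fe f3 mB B0 HB.
have G0 : growth (fun n => normc (nderive (2 * n + e) f x)) b.
  by exists D => n; apply: HD; rewrite subrr normc0.
have G1 : growth (fun n => normc (nderive (2 * n + e).+1 f x)) b.
  exists D => n; rewrite -[leRHS]divr1.
  apply: (entire_cauchy (entire_nderive (2 * n + e) fe) ltr01) => w wx.
  by apply: HD; rewrite wx.
apply: growth_of_parities => e' e'1; rewrite mulrC divfK//.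
have [e0|e0] : e = 0%N \/ e = 1%N by lia.
  have [e'0|e'0] : e' = 0%N \/ e' = 1%N by lia.
    by move: G0; rewrite e'0 e0.
  rewrite e'0; move: G1; rewrite e0.
  by under [X in growth X]eq_fun => n do rewrite addn0 -addn1.
have [e'0|e'0] : e' = 0%N \/ e' = 1%N by lia.
  rewrite e'0; apply: growth_shift; have [D' HD'] := G1.
  exists D' => n; have := HD' n.
  by have -> : (2 * n + e).+1 = (2 * n.+1 + 0)%N by rewrite e0; lia.
by move: G0; rewrite e'0 e0.
Qed.
End Propagation.

(** * The exceptional set *)

Section AlmostEverywhere.
Context {R : realType}.
Local Notation C := (Cplx R).
Local Notation leb := (@lebesgue_measure R).

Lemma measurable_sublevels (G : nat -> C -> C) (c : nat -> R) :
  (forall n, ccontinuous (G n)) ->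
  measurable [set p : R * R | forall n, normc (G n (p.1 +i* p.2)) <= c n].
Proof.
move=> Gc; rewrite -[X in measurable X]setCK; apply: measurableC.
apply: measurable_box_open => -[x y] /=.
move=> /existsNP[n /negP]; rewrite -ltNge => cn.
pose e := (normc (G n (x +i* y)) - c n) / 2.
have e0 : 0 < e by rewrite divr_gt0// subr_gt0.
have [d d0 Hd] := Gc n (x +i* y) e e0.
exists (d / 2); first by rewrite divr_gt0.
move=> [x' y'] /= xx yy; apply/existsNP; exists n; apply/negP; rewrite -ltNge.
have H : normc (G n (x' +i* y') - G n (x +i* y)) <= e.
  apply: Hd; apply: (le_lt_trans (normc_le_abs (x' - x) (y' - y))).
  by rewrite (splitr d) ltrD.
have := normc_tri (G n (x +i* y)) (G n (x' +i* y')) 0; rewrite !subr0 => H2.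
have e2 : normc (G n (x +i* y)) = c n + 2 * e by rewrite /e; field.
move: H2; rewrite e2 normcB; move: H e0.
move: (normc _) (normc _) => u v H e0 H2; lra.
Qed.

Variable F : C -> C -> C.
Hypothesis (Fe : entire2 F) (Fh : heat_equation F).

(** The exponent beta = 2 - 2/r belongs to the order r / (2 - r).  The set is
    covered by the sets A j, where one bound of exponent beta - 1/(j+1) holds
    throughout.  If a vertical section of A j had positive length, that bound
    would spread to all z-derivatives and make the order of F t0 less than r.
    So all the sections are null. *)
Lemma torder_small_negligible (t0 : C) e (r : R) : (e <= 1)%N -> 0 < r ->
  z_order F t0 = r%:E ->
  (leb \x leb)%E.-negligible [set p : R * R | exists s, [/\ 0 < s,
    s * (2 - r) < r & (torder F e (p.1 +i* p.2) < s%:E)%E]].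
Proof.
move=> e1 r0 Fr; have Fte := (heat_entire Fe Fh t0).1.
have r2 : r <= 2 by have := z_order_le2 Fe Fh t0; rewrite Fr lee_fin.
pose beta : R := 2 - 2 / r.
pose c (j n : nat) := expR (j%:R * n.+1%:R + (beta - j.+1%:R^-1) * xlogx n).
pose A (j : nat) := [set p : R * R | forall n,
  normc (nderive (2 * n + e) (F t0) (p.1 +i* p.2)) <= c j n].
have mA j : measurable (A j).
  apply: (@measurable_sublevels (fun n => nderive (2 * n + e) (F t0)) (c j)).
  move=> n.
  exact: (entire_ccontinuous (entire_nderive (2 * n + e) Fte)).
have nA : (leb \x leb)%E.-negligible (\bigcup_j A j).
  apply: negligible_bigcup => j; apply: negligible_sections => // x.
  have mx : measurable (xsection (A j) x) by exact: measurable_xsection.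
  apply/eqP; rewrite eq_le measure_ge0 andbT leNgt; apply/negP => B0.
  have F3 : (entire_order (F t0) < 3%:E)%E.
    by rewrite -[entire_order _]/(z_order F t0) Fr lte_fin; lra.
  pose b := beta - j.+1%:R^-1.
  have j0 : 0 < j.+1%:R^-1 :> R by rewrite invr_gt0.
  have ri : 0 < r^-1 by rewrite invr_gt0.
  have : growth (fun n => normc (nderive n (F t0) x%:C)) (b / 2).
    apply: (@growth_of_line R (F t0) e b x%:C _ e1 Fte F3 mx B0).
    exists j%:R => y; rewrite xsectionE /= => Ay n.
    have -> : x%:C + y *i = x +i* y.
      by apply/eqP; rewrite eq_complex /= addr0 add0r !eqxx.
    exact: Ay.
  pose s' := (1 - b / 2)^-1.
  have s'0 : 0 < 1 - b / 2.
    by rewrite /b /beta; move: (r^-1) (j.+1%:R^-1) ri j0 => u v; lra.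
  have -> : b / 2 = 1 - s'^-1 by rewrite /s' invrK; ring.
  move=> /(order_le_growth Fte)/= H.
  have : (z_order F t0 <= s'%:E)%E by apply: H; rewrite invr_gt0.
  rewrite Fr lee_fin leNgt => /negP; apply.
  rewrite /s' -[ltRHS]invrK ltf_pV2 ?posrE ?invr_gt0//.
  by rewrite /b /beta; move: (r^-1) (j.+1%:R^-1) ri j0 => u v; lra.
apply: negligibleS nA => -[x y] /= [s [s0 sr Hs]].
have [D HD] := growth_torder Fe Fh t0 s0 Hs.
(* j dominates D as well as the inverse distance from 1 - 1/s to beta *)
pose gap := beta - (1 - s^-1).
have gap0 : 0 < gap.
  have -> : gap = (r - s * (2 - r)) / (r * s).
    by rewrite /gap /beta; field; rewrite !gt_eqF.
  by rewrite divr_gt0 ?mulr_gt0// subr_gt0.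
pose j := (Num.truncn (`|D| + gap^-1)).+1.
have jD : `|D| + gap^-1 < j%:R by exact: truncnS_gt.
have g0 : 0 < gap^-1 by rewrite invr_gt0.
exists j => // n; apply: le_trans (HD n) _; rewrite /c ler_expR; apply: lerD.
  apply: ler_wpM2r => //; rewrite (le_trans (ler_norm _))//.
  by move: jD g0; lra.
apply: ler_wpM2r; first by rewrite mulr_ge0 ?ln_nat_ge0.
rewrite lerBrDl -lerBrDr -/gap -[leRHS]invrK lef_pV2 ?posrE ?invr_gt0//.
by rewrite -natr1; have := normr_ge0 D; move: jD; lra.
Qed.
End AlmostEverywhere.

Lemma ereal_between {R : realType} (x y : \bar R) : (0 <= x)%E -> (x < y)%E ->
  exists s : R, [/\ 0 < s, (x < s%:E)%E & (s%:E < y)%E].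
Proof.
case: x => [a| |]; case: y => [b| |] //; rewrite ?lte_fin ?lee_fin => a0 ab.
  exists ((a + b) / 2); rewrite !lte_fin; split; lra.
by exists (a + 1); rewrite lte_fin ltry; split => //; lra.
Qed.

Local Open Scope ereal_scope.

(* In [\bar R] one has 0^-1 = +oo, so that rho / (2 - rho) = +oo for rho = 2. *)
Theorem theorem4 (R : realType) (F : Cplx R -> Cplx R -> Cplx R)
    (F_entire : entire2 F) (F_heat : heat_equation F)
    (t0 : Cplx R) (rho : \bar R) (rho_def : rho = z_order F t0) :
  (0 <= rho <= 2%:E) /\
  exists rho_t : \bar R,
    [/\ (forall z : Cplx R, maxe (t_order0 F z) (t_order1 F z) = rho_t),
        [/\ rho_t = rho / (2%:E - rho),
            (rho = 2%:E -> rho_t = +oo),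
            (rho < 2%:E -> rho_t \is a fin_num) &
            (rho_t = 0 <-> rho = 0)],
        ae_complex (fun z => t_order0 F z = rho_t) &
        ae_complex (fun z => t_order1 F z = rho_t)].
Proof.
have rho0 : 0 <= rho.
  by rewrite rho_def; exact: (order_ge0 (heat_entire F_entire F_heat t0).1).
have rho2 : rho <= 2%:E by rewrite rho_def; exact: z_order_le2.
split; first by rewrite rho0 rho2.
have [r rE] : exists r : R, rho = r%:E.
  by move: rho0 rho2; case: (rho) => [r _ _|//|//]; exists r.
rewrite {}rE in rho_def rho0 rho2 *; rewrite !lee_fin in rho0 rho2.
have tau_lt (r2 : (r < 2)%R) : r%:E / (2%:E - r%:E) = (r / (2 - r))%:E.
  by rewrite -EFinB inver gt_eqF ?subr_gt0// EFinM.
have tau_2 (r2 : r = 2%R) : r%:E / (2%:E - r%:E) = +oo.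
  by rewrite -EFinB r2 subrr inver eqxx gt0_muley.
have r_cases : (r < 2)%R \/ r = 2%R.
  by move: rho2; rewrite le_eqVlt => /orP[/eqP|]; [right|left].
pose tau := r%:E / (2%:E - r%:E).
have tau0 : 0 <= tau.
  have [r2|r2] := r_cases; last by rewrite /tau tau_2.
  by rewrite /tau tau_lt// lee_fin divr_ge0// subr_ge0 ltW.
have lt_tau (s : R) : (0 < s)%R -> s%:E < tau -> (s * (2 - r) < r)%R.
  move=> s0; have [r2|r2] := r_cases.
    by rewrite /tau tau_lt// lte_fin ltr_pdivlMr// subr_gt0.
  by rewrite r2 subrr mulr0.
have le_tau e z : (e <= 1)%N -> torder F e z <= tau.
  move=> e1; have [r2|r2] := r_cases; last by rewrite /tau tau_2// leey.
  rewrite /tau tau_lt//; apply/lee_addgt0Pr => d d0; rewrite -EFinD.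
  (* u = s / (2 - s) for s = 2 u / (1 + u), and r < s < 2 *)
  pose u := (r / (2 - r) + d)%R.
  have u0 : (0 < u)%R by rewrite ltr_wpDl// divr_ge0// subr_ge0 ltW.
  have u1 : (0 < 1 + u)%R by rewrite addr_gt0.
  have ur : (r < u * (2 - r))%R.
    by rewrite -ltr_pdivrMr ?subr_gt0// /u ltrDl.
  have uE : u = (2 * u / (1 + u) / (2 - 2 * u / (1 + u)))%R.
    field; rewrite gt_eqF//= mulrDr mulr1 addrK.
    by rewrite pnatr_eq0.
  rewrite -/u {1}uE; apply: (@torder_le R F F_entire F_heat t0 e z _ e1).
    by rewrite divr_gt0 ?mulr_gt0//= ltr_pdivrMr//; lra.
  rewrite -rho_def lte_fin ltr_pdivlMr//; move: ur; rewrite mulrBr; lra.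
have max_tau z : maxe (t_order0 F z) (t_order1 F z) = tau.
  have le0 : t_order0 F z <= tau := le_tau 0%N z isT.
  have le1 : t_order1 F z <= tau := le_tau 1%N z isT.
  apply/le_anti/andP; split.
    by rewrite ge_max; apply/andP; split; [exact: le0|exact: le1].
  rewrite leNgt; apply/negP => H; have [|s [s0 Hs st]] := ereal_between _ H.
    rewrite le_max; apply/orP; left.
    have [te _] := heat_time_nderive F_entire F_heat 0 z.
    exact: (order_ge0 te).
  move: Hs; rewrite gt_max => /andP[H0 H1].
  have := z_order_le F_entire F_heat t0 s0 H0 H1.
  rewrite -rho_def lee_fin leNgt => /negP; apply.
  rewrite ltr_pdivrMr ?addr_gt0//; have := lt_tau s s0 st; lra.
have ae_tau e : (e <= 1)%N -> ae_complex (fun z => torder F e z = tau).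
  move=> e1; rewrite /ae_complex /almost_everywhere.
  have order0 z : 0 <= torder F e z.
    have [te _] := heat_time_nderive F_entire F_heat e z.
    exact: (order_ge0 te).
  have [r00|rn0] := eqVneq r 0%R.
    apply: negligibleS (negligible_set0 _) => p /=; apply.
    apply/eqP; rewrite eq_le le_tau//=.
    suff -> : tau = 0 by [].
    by rewrite /tau r00 mul0e.
  have r0 : (0 < r)%R by rewrite lt_def rn0.
  apply: negligibleS (torder_small_negligible F_entire F_heat e1 r0 _).
    move=> p /= Hp; have : torder F e (Complex p.1 p.2) < tau.
      by rewrite lt_neqAle le_tau// andbT; apply/eqP.
    move=> /(ereal_between (order0 _))[s [s0 Hs st]].
    by exists s; split => //; exact: lt_tau.
  exact: (esym rho_def).
exists tau; split => //.
- split => //.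
  + by move=> [r2]; rewrite /tau tau_2.
  + by rewrite lte_fin => r2; rewrite /tau tau_lt.
  + split=> [|[r00]]; last by rewrite /tau r00 mul0e.
    have [r2|r2] := r_cases; last by rewrite /tau tau_2.
    rewrite /tau tau_lt// => -[/eqP]; rewrite mulf_eq0 invr_eq0 subr_eq0.
    by rewrite (gt_eqF r2) orbF => /eqP ->.
- exact: (ae_tau 0%N).
- exact: (ae_tau 1%N).
Qed.
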